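(* Let an arbitrary Markov chain on an arbitrary measurable space $(X,\Sigma)$ satisfy $\dim\Delta_{ba}=1$. Then the following conditions hold: $(D)$: there exist a bounded measure $\varphi\in ca(X,\Sigma)$, $\varphi\ge 0$, $\varepsilon>0$ and an integer $k\ge 1$ such that for every $E\in\Sigma$, $\varphi(E)\le\varepsilon$ implies $p^k(x,E)\le 1-\varepsilon$ for all $x\in X$; $(\tilde D)$: there exist a bounded measure $\varphi\in ca(X,\Sigma)$, $\varphi\ge 0$, $\varepsilon>0$ and an integer $m\ge 1$ such that for every $E\in\Sigma$, $\varphi(E)<\varepsilon$ implies $\frac1m\sum_{k=1}^m p^k(x,E)\le 1-\varepsilon$ for all $x\in X$; $(K)$: there exist a compact operator $A_1:ca(X,\Sigma)\to ca(X,\Sigma)$ and an integer $k\ge 1$ such that $\|A^k-A_1\|<1$, where $A$ is considered on $ca(X,\Sigma)$ (i.e. the chain is quasicompact). Moreover, $\Delta_{ba}=\Delta_{ca}=\{\mu\}\subset ca(X,\Sigma)$ for some measure $\mu$, i.e. the condition $( * )$: $\Delta_{ba}\subset ca(X,\Sigma)$ holds.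
   Context: $X$ is an arbitrary infinite set and $\Sigma$ is a $\sigma$-algebra of subsets of $X$ containing all singletons. $B(X,\Sigma)$ is the Banach space of bounded $\Sigma$-measurable functions $f:X\to\mathbb{R}$ with the sup-norm. $ba(X,\Sigma)$ is the Banach space of bounded finitely additive measures $\mu:\Sigma\to\mathbb{R}$ with the total variation norm, and $ca(X,\Sigma)$ is its subspace of countably additive measures. $S_{ba}=\{\mu\in ba(X,\Sigma):\mu\ge 0,\ \|\mu\|=1\}$, $S_{ca}=S_{ba}\cap ca(X,\Sigma)$. A Markov chain is given by a transition function $p(x,E)$, $x\in X$, $E\in\Sigma$, with $0\le p(x,E)\le 1$, $p(x,X)=1$, $p(\cdot,E)\in B(X,\Sigma)$ for all $E\in\Sigma$, and $p(x,\cdot)\in ca(X,\Sigma)$ for all $x\in X$. Its iterates are $p^1=p$, $p^{k+1}(x,E)=\int_X p^k(y,E)\,p(x,dy)$. The Markov operator $A:ba(X,\Sigma)\to ba(X,\Sigma)$ is $A\mu(E)=\int_X p(x,E)\,\mu(dx)$; it maps $ca(X,\Sigma)$ into itself. $\Delta_{ba}=\{\mu\in S_{ba}: A\mu=\mu\}$, $\Delta_{ca}=\{\mu\in S_{ca}: A\mu=\mu\}$, and $\dim\Delta_{ba}$ is the dimension of the linear span of $\Delta_{ba}$. *)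

(* Defs.v *)
From HB Require Import structures.
From mathcomp Require Import all_boot all_order all_algebra finmap.
From mathcomp Require Import all_classical all_reals all_analysis.
From mathcomp Require Import measurable_realfun.
From mathcomp Require Import ring lra.

Set Implicit Arguments.
Unset Strict Implicit.
Unset Printing Implicit Defensive.

Import Order.TTheory GRing.Theory Num.Theory.
Import numFieldNormedType.Exports.
Import HBSimple.

Local Open Scope classical_set_scope.
Local Open Scope ring_scope.

Section linear_algebra.
Context {R : realType} {V : lmodType R}.

Definition linear_span (S : set V) : set V :=
  [set v | exists (n : nat) (a : 'I_n -> R) (w : 'I_n -> V),
     (forall i, S (w i)) /\ v = \sum_(i < n) a i *: w i].

(* W is meant to be a linear subspace *)
Definition has_dim (W : set V) (n : nat) : Prop :=
  exists b : 'I_n -> V,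
    [/\ forall i, W (b i),
        forall v, W v -> exists a : 'I_n -> R, v = \sum_(i < n) a i *: b i
      & forall a : 'I_n -> R, \sum_(i < n) a i *: b i = 0 ->
          forall i, a i = 0].

End linear_algebra.

Section operators.
Context {R : realType} {V W : normedModType R}.

(* extended-real valued, so that it is +oo on unbounded operators *)
Definition opnorm (f : V -> W) : \bar R :=
  ereal_sup [set (`|f x|)%:E | x in [set x : V | `|x| <= 1]].

Definition compact_operator (f : V -> W) : Prop :=
  forall B : set V, bounded_set B -> precompact (f @` B).

End operators.

Section set_functions.
Context d (T : measurableType d) (R : realType).
Implicit Types (mu nu : set T -> R) (f : T -> R).

Definition fin_additive mu := forall A B, measurable A -> measurable B ->
  A `&` B = set0 -> mu (A `|` B) = mu A + mu B.

Definition partition_sums mu : set R :=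
  [set v | exists (n : nat) (E : 'I_n -> set T),
    [/\ forall i, measurable (E i), trivIset setT E, \bigcup_i E i = setT
      & v = \sum_(i < n) `|mu (E i)|]].

Definition tv_norm mu : R := sup (partition_sums mu).

Definition simple_integral mu (s : {sfun T >-> R}) : R :=
  \sum_(r \in range s) r * mu (s @^-1` [set r]).

(* the integral of f is the limit of the integrals of simple functions that
   converge uniformly to f *)
Definition is_ba_integral mu f (l : R) : Prop :=
  forall e, 0 < e -> exists2 r, 0 < r &
    forall s : {sfun T >-> R}, (forall x, `|s x - f x| < r) ->
      `|simple_integral mu s - l| < e.

Definition ba_integral mu f : R := get (is_ba_integral mu f).

Section additive_theory.
Variable mu : set T -> R.
Hypothesis addmu : fin_additive mu.

Lemma fin_additive0 : mu set0 = 0.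
Proof.
have := addmu measurable0 measurable0 (setI0 set0).
rewrite setU0 => h; lra.
Qed.

Lemma fin_additive_big (I : finType) (P : pred I) (E : I -> set T) :
  (forall i, measurable (E i)) -> trivIset setT E ->
  mu (\big[setU/set0]_(i | P i) E i) = \sum_(i | P i) mu (E i).
Proof.
move=> mE /trivIsetP tE.
rewrite -!(big_filter (index_enum I)).
have : uniq [seq i <- index_enum I | P i].
  by rewrite filter_uniq// index_enum_uniq.
elim: [seq i <- index_enum I | P i] => [_|i s IH].
  by rewrite !big_nil fin_additive0.
rewrite /= => /andP[si us]; rewrite !big_cons addmu ?IH//.
  exact: bigsetU_measurable.
rewrite -bigcup_seq; apply/seteqP; split=> // x [Eix [j /= js Ejx]].
have ij : i != j by apply: contraNneq si => ->.
by have := tE _ _ Logic.I Logic.I ij; rewrite -subset0 => /(_ x); apply.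
Qed.

Lemma trivIset_sum_le (I : finType) (E : I -> set T) M :
  (forall A, measurable A -> `|mu A| <= M) ->
  (forall i, measurable (E i)) -> trivIset setT E ->
  \sum_i `|mu (E i)| <= M + M.
Proof.
move=> bM mE tE; rewrite (bigID (fun i => 0 <= mu (E i)))/=.
apply: lerD.
  rewrite (eq_bigr (fun i => mu (E i))); last by move=> i /ger0_norm.
  rewrite -fin_additive_big//; apply: le_trans (ler_norm _) (bM _ _).
  exact: bigsetU_measurable.
rewrite (eq_bigr (fun i => - mu (E i))); last first.
  by move=> i; rewrite -ltNge => /ltr0_norm.
rewrite sumrN -fin_additive_big//.
apply: le_trans (ler_norm _) _.
by rewrite normrN; apply: bM; exact: bigsetU_measurable.
Qed.

Lemma simple_integralE (s : {sfun T >-> R}) (I : finType) (E : I -> set T)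
    (c : I -> R) :
  (forall i, measurable (E i)) -> trivIset setT E ->
  \bigcup_i E i = setT -> (forall i x, E i x -> s x = c i) ->
  simple_integral mu s = \sum_i c i * mu (E i).
Proof.
move=> mE tE cE sE.
rewrite /simple_integral fsbig_finite//=.
have muE r : mu (s @^-1` [set r]) = \sum_(i | c i == r) mu (E i).
  rewrite -fin_additive_big//; congr mu.
  rewrite -bigcup_seq_cond; apply/seteqP; split=> x /=.
    move=> sxr; have : [set: T] x by [].
    rewrite -cE => -[i _ Eix]; exists i => //=.
    by rewrite mem_index_enum -(sE _ _ Eix) sxr eqxx.
  by move=> [i /= /andP[_ /eqP <-] Eix]; rewrite (sE _ _ Eix).
under eq_bigr do rewrite muE big_distrr/=.
rewrite (exchange_big_dep xpredT)//=; apply: eq_bigr => i _.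
have [E0|/set0P[x Eix]] := eqVneq (E i) set0.
  by rewrite E0 fin_additive0 mulr0 big1// => r _; rewrite mulr0.
rewrite (eq_bigr (fun=> c i * mu (E i))); last by move=> r /eqP <-.
have ci : c i \in fset_set (range s).
  rewrite in_fset_set//; apply/mem_set.
  by exists x => //; exact: sE Eix.
rewrite big_mkcond (bigD1_seq (c i) ci (fset_uniq _))/= eqxx big1 ?addr0// => r rc.
by rewrite eq_sym (negbTE rc).
Qed.

Lemma simple_common_partition (s t : {sfun T >-> R}) :
  exists n (E : 'I_n -> set T) (a b : 'I_n -> R),
    [/\ forall i, measurable (E i), trivIset setT E, \bigcup_i E i = setT,
        forall i x, E i x -> s x = a i & forall i x, E i x -> t x = b i].
Proof.
pose L := [seq (x, y) | x <- fset_set (range s), y <- fset_set (range t)].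
have uL : uniq L by apply: allpairs_uniq => // -[? ?] [? ?] _ _ [-> ->].
exists (size L), (fun i => [set x | (s x, t x) = nth (0, 0) L i]),
  (fun i => (nth (0, 0) L i).1), (fun i => (nth (0, 0) L i).2); split.
- move=> i; rewrite (_ : mkset _ = s @^-1` [set (nth (0, 0) L i).1] `&`
    t @^-1` [set (nth (0, 0) L i).2]); first exact: measurableI.
  by apply/seteqP; split=> x /=; [move=> <-|case: nth => ? ? /= [-> ->]].
- apply/trivIsetP => i j _ _ ij; rewrite -subset0 => x /= [-> /eqP].
  by rewrite nth_uniq// => /eqP/val_inj/eqP; exact/negP.
- rewrite -subTset => x _.
  have xL : (s x, t x) \in L.
    by apply: allpairs_f; rewrite in_fset_set//; apply/mem_set; exists x.
  by move: (xL); rewrite -index_mem => iL; exists (Ordinal iL) => //=; rewrite nth_index.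
- by move=> i x /= <-.
- by move=> i x /= <-.
Qed.

Lemma partition_sums_neq0 : partition_sums mu !=set0.
Proof.
exists `|mu setT|; exists 1%N, (fun=> setT); split => //.
- by apply/trivIsetP => i j _ _; rewrite !ord1 eqxx.
- by rewrite -subTset => x _; exists ord0.
- by rewrite big_ord1.
Qed.

Hypothesis bmu : exists M, forall A, measurable A -> `|mu A| <= M.

Lemma has_ubound_partition_sums : has_ubound (partition_sums mu).
Proof.
have [M bM] := bmu; exists (M + M) => _ [n [E [mE tE cE ->]]].
exact: trivIset_sum_le.
Qed.

Lemma le_tv_norm (I : finType) (E : I -> set T) :
  (forall i, measurable (E i)) -> trivIset setT E -> \bigcup_i E i = setT ->
  \sum_i `|mu (E i)| <= tv_norm mu.
Proof.
move=> mE /trivIsetP tE cE; apply: ub_le_sup; first exact: has_ubound_partition_sums.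
exists #|I|, (fun i => E (enum_val i)); split.
- by move=> i; exact: mE.
- apply/trivIsetP => i j _ _ ij; apply: tE => //.
  by apply: contra_neq ij; exact: enum_val_inj.
- rewrite -subTset -cE => x [i _ Eix]; exists (enum_rank i) => //=.
  by rewrite enum_rankK.
- by rewrite (reindex (@enum_val _ I))//; exact/onW_bij/enum_val_bij.
Qed.

Lemma tv_norm_ge0 : 0 <= tv_norm mu.
Proof.
apply: le_trans (le_tv_norm (I := unit) (E := fun=> setT) _ _ _) => //.
- exact: sumr_ge0.
- by apply/trivIsetP => -[] [].
- by rewrite -subTset => x _; exists tt.
Qed.

Lemma simple_integral_dist (s t : {sfun T >-> R}) k :
  (forall x, `|s x - t x| <= k) ->
  `|simple_integral mu s - simple_integral mu t| <= k * tv_norm mu.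
Proof.
move=> stk; have k0 : 0 <= k := le_trans (normr_ge0 _) (stk point).
have [n [E [a [b [mE tE cE sE tE']]]]] := simple_common_partition s t.
rewrite (simple_integralE mE tE cE sE) (simple_integralE mE tE cE tE').
rewrite -sumrB.
apply: le_trans (ler_norm_sum _ _ _) _.
apply: (@le_trans _ _ (\sum_i k * `|mu (E i)|)); last first.
  by rewrite -mulr_sumr ler_wpM2l// le_tv_norm.
apply: ler_sum => i _; rewrite -mulrBl normrM.
have [->|/set0P[x Eix]] := eqVneq (E i) set0.
  by rewrite fin_additive0 normr0 !mulr0.
by rewrite ler_wpM2r// -(sE _ _ Eix) -(tE' _ _ Eix).
Qed.

Lemma simple_integralD (s t : {sfun T >-> R}) :
  simple_integral mu (s + t) = simple_integral mu s + simple_integral mu t.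
Proof.
have [n [E [a [b [mE tE cE sE tE']]]]] := simple_common_partition s t.
rewrite (simple_integralE mE tE cE sE) (simple_integralE mE tE cE tE').
rewrite (simple_integralE (c := fun i => a i + b i) mE tE cE); last first.
  by move=> i x Eix; rewrite sfunD/= (sE _ _ Eix) (tE' _ _ Eix).
by rewrite -big_split/=; apply: eq_bigr => i _; rewrite mulrDl.
Qed.

Definition uniformly_simple f :=
  forall e, 0 < e -> exists s : {sfun T >-> R}, forall x, `|s x - f x| <= e.

Lemma ba_integral_exists f : uniformly_simple f -> exists l,
  forall (s : {sfun T >-> R}) k, (forall x, `|s x - f x| <= k) ->
    `|simple_integral mu s - l| <= k * tv_norm mu.
Proof.
move=> usf; set V := tv_norm mu.
pose S := [set v | exists (s : {sfun T >-> R}) k,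
  (forall x, `|s x - f x| <= k) /\ v = simple_integral mu s - k * V].
have ubS (t : {sfun T >-> R}) k : (forall x, `|t x - f x| <= k) ->
    ubound S (simple_integral mu t + k * V).
  move=> tk _ [s [h [sh ->]]].
  have /simple_integral_dist : forall x, `|s x - t x| <= h + k.
    move=> x; rewrite -(subrKA (f x)).
    by apply: le_trans (ler_normD _ _) _; rewrite lerD// distrC.
  rewrite mulrDl -/V => /ler_normlP[_]; lra.
exists (sup S) => s k sk; apply/ler_normlP; split.
  rewrite opprB lerBlDr [leRHS]addrC; apply: ge_sup; last exact: ubS.
  by exists (simple_integral mu s - k * V), s, k.
rewrite lerBlDr -lerBlDl; apply: ub_le_sup; last by exists s, k.
by exists (simple_integral mu s + k * V); exact: ubS.
Qed.

Lemma is_ba_integral_unique f l l' : uniformly_simple f ->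
  is_ba_integral mu f l -> is_ba_integral mu f l' -> l = l'.
Proof.
move=> usf fl fl'; apply/eqP; rewrite -subr_eq0 -normr_le0.
apply/ler_addgt0Pr => e e0; rewrite add0r.
have e20 : 0 < e / 2 by rewrite divr_gt0.
have [r r0 lr] := fl _ e20; have [r' r'0 lr'] := fl' _ e20.
have rr0 : 0 < Num.min r r' / 2 by rewrite divr_gt0// lt_min r0.
have [s sf] := usf _ rr0.
have {}sf x : `|s x - f x| < Num.min r r'.
  by apply: le_lt_trans (sf x) _; rewrite ltr_pdivrMr// ltr_pMr ?lt_min ?r0 ?ltr1n.
have /lr : forall x, `|s x - f x| < r.
  by move=> x; apply: lt_le_trans (sf x) _; rewrite ge_min lexx.
have /lr' : forall x, `|s x - f x| < r'.
  by move=> x; apply: lt_le_trans (sf x) _; rewrite ge_min lexx orbT.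
move=> h1 h2; rewrite -(subrKA (simple_integral mu s)).
apply: le_trans (ler_normD _ _) _; rewrite distrC; lra.
Qed.

Lemma ba_integral_approx f (s : {sfun T >-> R}) k : uniformly_simple f ->
  (forall x, `|s x - f x| <= k) ->
  `|simple_integral mu s - ba_integral mu f| <= k * tv_norm mu.
Proof.
move=> usf sk; have [l fl] := ba_integral_exists usf.
suff -> : ba_integral mu f = l by exact: fl.
have isl : is_ba_integral mu f l.
  move=> e e0; have V0 := tv_norm_ge0.
  exists (e / (tv_norm mu + 1)); first by rewrite divr_gt0//; lra.
  move=> t tf; apply: le_lt_trans (fl t _ (fun x => ltW (tf x))) _.
  by rewrite mulrAC ltr_pdivrMr ?ltr_pM2l//; lra.
apply: (is_ba_integral_unique usf _ isl).
exact: (getPex (ex_intro _ l isl)).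
Qed.

Lemma ba_integralP f l : uniformly_simple f ->
  is_ba_integral mu f l -> ba_integral mu f = l.
Proof.
move=> usf fl; apply: (is_ba_integral_unique usf _ fl).
exact: (getPex (ex_intro _ l fl)).
Qed.

Lemma ba_integralD f g : uniformly_simple f -> uniformly_simple g ->
  ba_integral mu (f \+ g) = ba_integral mu f + ba_integral mu g.
Proof.
move=> usf usg; have V0 := tv_norm_ge0.
have usfg : uniformly_simple (f \+ g).
  move=> e e0; have e20 : 0 < e / 2 by rewrite divr_gt0.
  have [s sf] := usf _ e20; have [t tg] := usg _ e20.
  exists (s + t) => x; rewrite sfunD/= opprD addrACA [e]splitr.
  by apply: le_trans (ler_normD _ _) _; rewrite lerD.
apply/eqP; rewrite -subr_eq0 -normr_le0.
apply/ler_addgt0Pr => e e0; rewrite add0r.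
have d0 : 0 < e / (4 * (tv_norm mu + 1)).
  by rewrite divr_gt0// mulr_gt0//; lra.
set h := e / _ in d0.
have [s sf] := usf _ d0; have [t tg] := usg _ d0.
have stfg x : `|(s + t) x - (f \+ g) x| <= h + h.
  rewrite sfunD/= opprD addrACA.
  by apply: le_trans (ler_normD _ _) _; rewrite lerD.
have hV : h * tv_norm mu <= e / 4.
  rewrite /h mulrAC ler_pdivrMr ?mulr_gt0//; last by lra.
  by rewrite mulrA divfK// ler_pM2l//; lra.
have := ba_integral_approx usfg stfg.
have := ba_integral_approx usg tg.
have := ba_integral_approx usf sf.
rewrite simple_integralD mulrDl => /ler_normlP[? ?] /ler_normlP[? ?] /ler_normlP[? ?].
apply/ler_normlP; split; lra.
Qed.

Lemma ba_integral_le f k : uniformly_simple f -> (forall x, `|f x| <= k) ->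
  `|ba_integral mu f| <= k * tv_norm mu.
Proof.
move=> usf fk.
have := @ba_integral_approx f (cst_sfun 0) k usf.
rewrite (_ : simple_integral mu (cst_sfun 0) = 0).
  by rewrite sub0r normrN; apply => x; rewrite sub0r normrN.
rewrite (@simple_integralE _ unit (fun=> setT) (fun=> 0))//.
- by rewrite big1// => *; rewrite mul0r.
- by apply/trivIsetP => -[] [].
- by rewrite -subTset => x _; exists tt.
Qed.

End additive_theory.

(* v plays the role of the variation of mu *)
Lemma ba_integral_le_off mu f (v : set T -> R) (G : set T) h :
  fin_additive mu -> (exists M, forall A, measurable A -> `|mu A| <= M) ->
  uniformly_simple f -> fin_additive v -> (forall A, measurable A -> `|mu A| <= v A) ->
  measurable G -> (forall x, 0 <= f x <= 1) -> (forall x, ~ G x -> f x <= h) ->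
  0 <= h -> `|ba_integral mu f| <= v G + h * v setT.
Proof.
move=> addmu bmu usf addv muv mG f01 fG h0.
have V0 := tv_norm_ge0 addmu bmu.
have v0 A : measurable A -> 0 <= v A.
  by move=> /muv; apply: le_trans; exact: normr_ge0.
have vle A : measurable A -> v A <= v setT.
  move=> mA; rewrite -(setUv A) addv ?lerDl ?v0//; last exact: setICr.
  - exact: measurableC.
  - exact: measurableC.
apply/ler_addgt0Pr => e e0.
pose k := e / (tv_norm mu + v setT + 1).
have vT0 : 0 <= v setT by exact: v0.
have k0 : 0 < k by rewrite divr_gt0//; lra.
have [s sf] := usf _ k0.
have [n [E [a [b [mE tE cE sE GE]]]]] :=
  simple_common_partition s (indic_sfun _ mG).
have {}GE i x : E i x -> (\1_G x : R) = b i by move=> /GE <-.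
have addvE : \sum_i v (E i) = v setT.
  rewrite -cE.
  have := fin_additive_big addv xpredT mE tE.
  move=> <-; congr v; rewrite -bigcup_seq.
  by apply/seteqP; split=> x [i _ Eix]; exists i => //=; rewrite mem_index_enum.
have sG : `|simple_integral mu s| <= v G + h * v setT + k * v setT.
  rewrite (simple_integralE addmu mE tE cE sE).
  apply: le_trans (ler_norm_sum _ _ _) _.
  rewrite -addrA -mulrDl -addvE mulr_sumr.
  have -> : v G = \sum_i v (E i `&` G).
    rewrite -(fin_additive_big addv xpredT (E := fun i => E i `&` G)).
    - congr v; rewrite -bigcup_seq -setI_bigcupl -[LHS]setTI -cE.
      congr (_ `&` _); apply/seteqP; split=> x [i _ Eix]; exists i => //=.
      by rewrite mem_index_enum.
    - by move=> i; exact: measurableI.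
    - exact: trivIset_setIr.
  rewrite -big_split/=; apply: ler_sum => i _; rewrite normrM.
  have [Ei0|/set0P[x Eix]] := eqVneq (E i) set0.
    have -> : mu (E i) = 0 by rewrite Ei0 (fin_additive0 addmu).
    rewrite normr0 mulr0 addr_ge0 ?mulr_ge0 ?v0//; first exact: measurableI.
    by rewrite addr_ge0// ltW.
  have sfx := sf x; have /andP[fx0 fx1] := f01 x.
  rewrite -(sE _ _ Eix).
  have vE0 := v0 _ (mE i); have muvE := muv _ (mE i).
  have [Gx|nGx] := pselect (G x).
    have -> : E i `&` G = E i.
      apply/setIidPl => y Eiy; apply/not_notP => nGy.
      have := GE _ _ Eiy; rewrite -(GE _ _ Eix) !indicE (mem_set Gx) (memNset nGy).
      by move/eqP; rewrite eq_sym oner_eq0.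
    apply: (@le_trans _ _ ((1 + k) * v (E i))).
      apply: ler_pM => //; move/ler_normlP : sfx => [? ?].
      by apply/ler_normlP; split; lra.
    rewrite !mulrDl mul1r addrA lerD2r lerDl mulr_ge0//.
  apply: (@le_trans _ _ ((h + k) * v (E i))); last first.
    by rewrite lerDr v0//; exact: measurableI.
  apply: ler_pM => //; have := fG _ nGx; move/ler_normlP : sfx => [? ? ?].
  by apply/ler_normlP; split; lra.
have := ba_integral_approx addmu bmu usf sf.
have kV : k * (tv_norm mu + v setT) <= e.
  rewrite /k mulrAC ler_pdivrMr ?ler_pM2l//; lra.
rewrite mulrDr in kV.
move: sG => /ler_normlP[? ?] /ler_normlP[? ?].
apply/ler_normlP; split; lra.
Qed.

Lemma uniformly_simple01 f : measurable_fun setT f ->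
  (forall x, 0 <= f x <= 1) -> uniformly_simple f.
Proof.
move=> mf f01 e e0.
pose N := (Num.truncn e^-1).+1.
have N0 : 0 < N%:R :> R by rewrite ltr0n.
have Ne : N%:R^-1 <= e.
  rewrite -[e]invrK lef_pV2 ?posrE ?invr_gt0//.
  exact/ltW/truncnS_gt.
pose G i := [set x | i.+1%:R <= N%:R * f x].
have mG i : measurable (G i).
  rewrite -[G i]setTI; apply: measurable_fun_le => //.
  by apply: measurable_funM.
exists (\sum_(i < N) (cst_sfun N%:R^-1 * indic_sfun _ (mG i))) => x.
rewrite sfun_sum; apply: le_trans Ne.
under eq_bigr do rewrite sfunM/=.
have /andP[fx0 fx1] := f01 x.
rewrite -mulr_sumr.
have -> : f x = N%:R^-1 * (N%:R * f x) by rewrite mulKf// gt_eqF.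
have Ni0 : 0 <= (N%:R : R)^-1 by rewrite invr_ge0 ltW.
rewrite -mulrBr normrM (ger0_norm Ni0); apply: ler_piMr => //.
set y := N%:R * f x.
have y0 : 0 <= y by rewrite mulr_ge0// ltW.
have yN : y <= N%:R by rewrite ler_piMr// ltW.
have -> : \sum_(i < N) indic_sfun _ (mG i) x = (Num.truncn y)%:R :> R.
  have kN : (Num.truncn y <= N)%N by rewrite -(@natrK R N); exact: le_truncn.
  rewrite -[in RHS](card_ord (Num.truncn y)) -sum1_card natr_sum.
  rewrite (big_ord_widen_cond N xpredT (fun=> 1))// [RHS]big_mkcond/=.
  apply: eq_bigr => i _; rewrite truncn_gt_nat.
  rewrite /indic_sfun/= mindicE; case: ifPn => yi.
    by rewrite mem_set.
  by rewrite memNset//; exact/negP.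
have := truncn_itv y0; rewrite -natr1 => /andP[? ?].
by apply/ler_normlP; split; lra.
Qed.

End set_functions.

Section ba_space.
Context d (T : measurableType d) (R : realType).

(* the values off the measurable sets are irrelevant; they are set to 0 so that
   two elements of ba are equal when they agree on measurable sets *)
Definition is_ba : {pred set T -> R} := fun mu =>
  `[< [/\ forall E, ~ measurable E -> mu E = 0,
          fin_additive mu
        & exists M, forall E, measurable E -> `|mu E| <= M] >].

Record ba := Ba { ba_fun :> set T -> R ; ba_funP : ba_fun \in is_ba }.

HB.instance Definition _ := [isSub for ba_fun].
HB.instance Definition _ := [Choice of ba by <:].

Lemma is_ba_submod_closed : submod_closed is_ba.
Proof.
split=> [|a u v /asboolP[u0 uD [M uM]] /asboolP[v0 vD [N vN]]]; apply/asboolP.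
  split => //=; first by move=> A B _ _ _; rewrite /= addr0.
  by exists 0 => A _; rewrite normr0.
split=> [E nE|A B mA mB AB|].
- by rewrite !fctE/= u0// v0// scaler0 addr0.
- by rewrite !fctE/= uD// vD// scalerDr addrACA.
- exists (`|a| * M + N) => A mA; apply: le_trans (ler_normD _ _) _.
  by rewrite lerD ?vN// normrM ler_wpM2l ?uM.
Qed.

HB.instance Definition _ := GRing.isSubmodClosed.Build _ _ is_ba
  is_ba_submod_closed.
HB.instance Definition _ := [SubChoice_isSubLmodule of ba by <:].

Implicit Types mu nu : ba.

Lemma ba_out mu E : ~ measurable E -> mu E = 0.
Proof. by have /asboolP[h _ _] := ba_funP mu; exact: h. Qed.

Lemma ba_additive mu : fin_additive mu.
Proof. by have /asboolP[] := ba_funP mu. Qed.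

Lemma ba_bounded mu : exists M, forall E, measurable E -> `|mu E| <= M.
Proof. by have /asboolP[] := ba_funP mu. Qed.

Lemma baP mu nu : (forall E, measurable E -> mu E = nu E) -> mu = nu.
Proof.
move=> munu; apply/val_inj/funext => E /=.
have [/munu//|nE] := pselect (measurable E).
by rewrite !ba_out.
Qed.

Lemma ba_variationD mu nu :
  tv_norm (ba_fun (mu + nu)) <= tv_norm mu + tv_norm nu.
Proof.
apply: ge_sup; first exact: partition_sums_neq0.
move=> _ [n [E [mE tE cE ->]]].
have := lerD (le_tv_norm (@ba_additive mu) (@ba_bounded mu) mE tE cE)
  (le_tv_norm (@ba_additive nu) (@ba_bounded nu) mE tE cE).
apply: le_trans; rewrite -big_split/=; apply: ler_sum => i _.
exact: ler_normD.
Qed.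

Lemma ba_variationZ a mu :
  tv_norm (ba_fun (a *: mu)) = `|a| * tv_norm mu.
Proof.
have le b nu : tv_norm (ba_fun (b *: nu)) <= `|b| * tv_norm nu.
  apply: ge_sup; first exact: partition_sums_neq0.
  move=> _ [n [E [mE tE cE ->]]].
  apply: le_trans (ler_wpM2l (normr_ge0 b)
    (le_tv_norm (@ba_additive nu) (@ba_bounded nu) mE tE cE)).
  by rewrite mulr_sumr; apply: ler_sum => i _; rewrite normrM.
apply/eqP; rewrite eq_le le/=.
have [->|a0] := eqVneq a 0.
  rewrite normr0 mul0r.
  exact: (tv_norm_ge0 (@ba_additive (0 *: mu)) (@ba_bounded (0 *: mu))).
have := le a^-1 (a *: mu); rewrite scalerA mulVf// scale1r.
by rewrite normfV -ler_pdivrMl ?invrK ?normr_gt0// invr_gt0 normr_gt0.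
Qed.

Lemma ba_le_variation mu E : measurable E -> `|mu E| <= tv_norm mu.
Proof.
move=> mE; pose F (b : bool) := if b then E else ~` E.
have mF b : measurable (F b) by case: b => //=; exact: measurableC.
apply: le_trans (le_tv_norm (@ba_additive mu) (@ba_bounded mu) mF _ _).
- by rewrite big_bool/= lerDl.
- apply/trivIsetP => -[] [] _ _ //= _; first exact: setICr.
  exact: setICl.
- rewrite -subTset => x _; have [Ex|nEx] := pselect (E x).
    by exists true.
  by exists false.
Qed.

Lemma ba_variation_eq0 mu : tv_norm mu = 0 -> mu = 0.
Proof.
move=> mu0; apply: baP => E mE; have := @ba_le_variation mu E mE.
by rewrite mu0 normr_le0 => /eqP.
Qed.

HB.instance Definition _ := @Lmodule_isNormed.Build R ba
  (fun mu => tv_norm mu) ba_variationD ba_variationZ ba_variation_eq0.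

Lemma ba_normE mu : `|mu| = tv_norm mu.
Proof. by []. Qed.

Definition is_ca : {pred ba} := fun mu =>
  `[< semi_sigma_additive (fun E => (mu E)%:E) >].

Record ca := Ca { ca_ba :> ba ; ca_baP : ca_ba \in is_ca }.

HB.instance Definition _ := [isSub for ca_ba].
HB.instance Definition _ := [Choice of ca by <:].

Lemma is_ca_submod_closed : submod_closed is_ca.
Proof.
split=> [|a u v /asboolP uS /asboolP vS]; apply/asboolP => F mF tF mUF.
  rewrite (_ : (fun n => _) = cst 0%E); first exact: cvg_cst.
  by apply/funext => n; rewrite big1.
rewrite (_ : (fun n => _) = (fun n => (a%:E * \sum_(0 <= i < n) (u (F i))%:E +
    \sum_(0 <= i < n) (v (F i))%:E)%E)).
  rewrite [X in _ --> X](_ : _ = (a%:E * (u (\bigcup_n F n))%:E +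
    (v (\bigcup_n F n))%:E)%E)//.
  apply: cvgeD => //; last exact: vS.
  by apply: cvgeZl => //; exact: uS.
apply/funext => n; rewrite !sumEFin -EFinM -EFinD mulr_sumr -big_split/=.
by congr EFin.
Qed.

HB.instance Definition _ := GRing.isSubmodClosed.Build _ _ is_ca
  is_ca_submod_closed.
HB.instance Definition _ := [SubChoice_isSubLmodule of ca by <:].

Lemma ca_normD (mu nu : ca) : `|ca_ba (mu + nu)| <= `|ca_ba mu| + `|ca_ba nu|.
Proof. exact: ler_normD. Qed.
Lemma ca_normZ a (mu : ca) : `|ca_ba (a *: mu)| = `|a| * `|ca_ba mu|.
Proof. exact: normrZ. Qed.
Lemma ca_norm_eq0 (mu : ca) : `|ca_ba mu| = 0 -> mu = 0.
Proof. by move/normr0_eq0 => mu0; exact: val_inj. Qed.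

HB.instance Definition _ := @Lmodule_isNormed.Build R ca
  (fun mu : ca => `|ca_ba mu|) ca_normD ca_normZ ca_norm_eq0.

Lemma ca_normE (mu : ca) : `|mu| = `|ca_ba mu|.
Proof. by []. Qed.

End ba_space.

Section markov.
Context d (T : measurableType d) (R : realType).
Variable p : R.-pker T ~> T.

Lemma pker_fin_num x E : measurable E -> p x E \is a fin_num.
Proof. exact: finite_kernel_measure. Qed.

Lemma pker01 E x : measurable E -> 0 <= fine (p x E) <= 1.
Proof.
move=> mE; rewrite fine_ge0//= -lee_fin fineK ?pker_fin_num//.
rewrite -(prob_kernel (s := p) x).
by apply: le_measure; rewrite ?inE.
Qed.

Lemma measurable_pker E : measurable E ->
  measurable_fun setT (fun x => fine (p x E)).
Proof.
by move=> mE; apply: measurableT_comp => //; exact: measurable_kernel.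
Qed.

Lemma uniformly_simple_pker E : measurable E ->
  uniformly_simple (fun x => fine (p x E)).
Proof.
by move=> mE; apply: uniformly_simple01 => [|x];
  [exact: measurable_pker|exact: pker01].
Qed.

Definition markov_fun (mu : ba T R) : set T -> R := fun E =>
  if `[< measurable E >] then ba_integral mu (fun x => fine (p x E)) else 0.

Lemma markov_fun_ba mu : markov_fun mu \in @is_ba d T R.
Proof.
apply/asboolP; rewrite /markov_fun; split=> [E nE|A B mA mB AB|].
- by case: asboolP.
- rewrite !asboolT//; last exact: measurableU.
  rewrite -ba_integralD//; [|exact: ba_additive|exact: ba_bounded
    |exact: uniformly_simple_pker|exact: uniformly_simple_pker].
  congr ba_integral; apply/funext => x /=.
  by rewrite measureU// fineD// pker_fin_num.
- exists (tv_norm mu) => A mA; rewrite asboolT// -[leRHS]mul1r.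
  apply: ba_integral_le; [exact: ba_additive|exact: ba_bounded
    |exact: uniformly_simple_pker|] => x.
  by have /andP[p0 p1] := pker01 x mA; rewrite ger0_norm.
Qed.

Definition markov (mu : ba T R) : ba T R := Ba (markov_fun_ba mu).

Lemma markovE mu E : measurable E ->
  markov mu E = ba_integral mu (fun x => fine (p x E)).
Proof. by move=> mE; rewrite /markov/= /markov_fun asboolT. Qed.

Lemma ca_variation (mu : ca T R) : exists2 v : {measure set T -> \bar R},
  fin_num_fun v & forall E, measurable E -> (`|mu E|%:E <= v E)%E.
Proof.
have nu0 : (mu set0)%:E = 0%E.
  by rewrite (fin_additive0 (@ba_additive _ _ _ mu)).
have nuf : forall E, measurable E -> (mu E)%:E \is a fin_num by [].
have /asboolP nuS := ca_baP mu.
pose nu : {charge set T -> \bar R} := HB.pack (fun E => (mu E)%:E)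
  (isCharge.Build _ T R (fun E => (mu E)%:E) nu0 nuf nuS).
have [P [N nuPN]] := Hahn_decomposition nu.
exists (charge_variation nuPN) => E mE.
  by rewrite /charge_variation fin_numD !fin_num_measure.
exact: (abse_charge_variation nuPN mE).
Qed.

Lemma markov_is_ca (mu : ca T R) : markov mu \in @is_ca d T R.
Proof.
apply/asboolP => F mF tF mU; set U := \bigcup_n F n in mU *.
pose Tl n := U `\` \big[setU/set0]_(i < n) F i.
have mTl n : measurable (Tl n).
  by apply: measurableD => //; exact: bigsetU_measurable.
have addA := @ba_additive _ _ _ (markov mu).
have AU n : \sum_(0 <= i < n) markov mu (F i) = markov mu U - markov mu (Tl n).
  rewrite big_mkord -(fin_additive_big addA xpredT (E := fun i : 'I_n => F i))//.
  - set B := \big[setU/set0]_(_ < _) _.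
    have mB : measurable B by exact: bigsetU_measurable.
    have BU : B `<=` U by rewrite /B -bigcup_mkord => x [k _ Fkx]; exists k.
    have -> : markov mu U = markov mu B + markov mu (Tl n).
      by rewrite -addA ?setDIK// /Tl setDUK.
    by rewrite addrK.
  - apply/trivIsetP => i j _ _ ij; move/trivIsetP : tF; exact.
rewrite (_ : (fun n => _) = (EFin \o (fun n => markov mu U - markov mu (Tl n)))).
  apply/cvg_EFin; first exact: nearW.
  rewrite -[X in _ --> X]subr0.
  apply: cvgB; first exact: cvg_cst.
  have [v vfin muv] := ca_variation mu.
  have Tl_nonincr : {homo Tl : n m / (n <= m)%N >-> (m <= n)%O}.
    move=> n m nm; rewrite subsetEset; apply: setDS; exact: subset_bigsetU.
  have Tl0 : \bigcap_n Tl n = set0.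
    rewrite -subset0 => x Tlx; have [[k _ Fkx] _] := Tlx 0%N Logic.I.
    have [_] := Tlx k.+1 Logic.I; apply.
    by rewrite -bigcup_mkord; exists k => /=.
  have cvgE (m : {measure set T -> \bar R}) (E : nat -> set T) :
      fin_num_fun m -> (forall n, measurable (E n)) ->
      {homo E : n m / (n <= m)%N >-> (m <= n)%O} -> \bigcap_n E n = set0 ->
      fine (m (E n)) @[n --> \oo] --> (0 : R).
    move=> mfin mE Eni E0.
    apply: fine_cvg; rewrite -[X in _ --> X](measure0 m) -E0.
    apply: nonincreasing_cvg_mu => //; last by rewrite E0.
    by rewrite ltey_eq mfin.
  have pfin x : fin_num_fun (p x) by exact: finite_kernel_measure.
  apply/cvgrPdist_le => e e0.
  have vT0 : 0 <= fine (v setT) by rewrite fine_ge0.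
  pose h := e / (2 * (fine (v setT) + 1)).
  have h0 : 0 < h by rewrite divr_gt0// mulr_gt0//; lra.
  have hv : h * fine (v setT) <= e / 2.
    by rewrite /h mulrAC ler_pdivrMr ?mulr_gt0//; lra.
  pose G n := [set x | h <= fine (p x (Tl n))].
  have mG n : measurable (G n).
    rewrite -[G n]setTI; apply: measurable_fun_le => //.
    exact: measurable_pker.
  have Gni : {homo G : n m / (n <= m)%N >-> (m <= n)%O}.
    move=> n m nm; rewrite subsetEset => x /= /le_trans; apply.
    rewrite fine_le ?pfin//; apply: le_measure; rewrite ?inE//.
    by have := Tl_nonincr _ _ nm; rewrite subsetEset.
  have G0 : \bigcap_n G n = set0.
    rewrite -subset0 => x Gx.
    have /cvgrPdist_lt/(_ _ h0)[N _ /(_ N (leqnn _))] :=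
      cvgE (p x) Tl (pfin x) mTl Tl_nonincr Tl0.
    have := Gx N Logic.I; rewrite /G/= => hp.
    by rewrite sub0r normrN ger0_norm ?fine_ge0// ltNge hp.
  have e20 : 0 < e / 2 by rewrite divr_gt0.
  have /cvgrPdist_lt/(_ _ e20) := cvgE v G vfin mG Gni G0.
  apply: filterS => n; rewrite !sub0r !normrN ger0_norm ?fine_ge0// => vG.
  rewrite markovE//; apply: (@le_trans _ _ (fine (v (G n)) + h * fine (v setT))).
    apply: (@ba_integral_le_off _ _ _ _ _ (fine \o v)) => //.
    - exact: ba_additive.
    - exact: ba_bounded.
    - exact: uniformly_simple_pker.
    - by move=> A B mA mB AB /=; rewrite measureU// fineD// vfin.
    - by move=> A mA; rewrite -lee_fin /= fineK ?vfin//; exact: muv.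
    - by move=> x; exact: pker01.
    - by move=> x /= /negP; rewrite -ltNge => /ltW.
    - exact: ltW.
  by lra.
by apply/funext => n /=; rewrite -AU sumEFin.
Qed.
Definition markov_ca (mu : ca T R) : ca T R := Ca (markov_is_ca mu).

(* p^0(x, .) is the Dirac mass at x, so that p^1 = p (iter_kernel1) *)
Fixpoint iter_kernel (k : nat) (x : T) (E : set T) : \bar R :=
  if k is k'.+1 then (\int[p x]_y iter_kernel k' y E)%E else \d_x E.

Lemma iter_kernel1 x E : measurable E -> iter_kernel 1 x E = p x E.
Proof.
move=> mE /=; transitivity (\int[p x]_y (\1_E y)%:E)%E.
  by apply: eq_integral => y _; rewrite diracE indicE.
by rewrite integral_indic// setIT.
Qed.

Definition ca_set : set (ba T R) := [set` @is_ca d T R].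

Definition S_ba : set (ba T R) :=
  [set mu : ba T R | (forall E, measurable E -> 0 <= mu E) /\ `|mu| = 1].

Definition S_ca : set (ba T R) := S_ba `&` ca_set.

Definition Delta_ba : set (ba T R) := [set mu | S_ba mu /\ markov mu = mu].

Definition Delta_ca : set (ba T R) := [set mu | S_ca mu /\ markov mu = mu].

Definition condition_D : Prop :=
  exists (phi : ca T R) (e : R) (k : nat),
    [/\ forall E, measurable E -> 0 <= phi E, 0 < e, (1 <= k)%N
      & forall E, measurable E -> phi E <= e ->
          forall x, (iter_kernel k x E <= (1 - e)%:E)%E].

Definition condition_D_tilde : Prop :=
  exists (phi : ca T R) (e : R) (m : nat),
    [/\ forall E, measurable E -> 0 <= phi E, 0 < e, (1 <= m)%N
      & forall E, measurable E -> phi E < e ->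
          forall x, ((m%:R^-1)%:E * \sum_(1 <= k < m.+1) iter_kernel k x E
                     <= (1 - e)%:E)%E].

Definition condition_K : Prop :=
  exists (A1 : {linear ca T R -> ca T R}) (k : nat),
    [/\ compact_operator A1, (1 <= k)%N
      & (opnorm (fun mu : ca T R => iter k markov_ca mu - A1 mu)%R < 1)%E].

End markov.

(* Main.v *)
(* Write P f(x) for the integral of f against p(x, .) and A_n for the Cesaro means
   of the iterates of P.  If A_n 1_E did not converge uniformly to mu(E), an
   ultrafilter limit of f |-> A_(n_i) f(x_i) would be an invariant finitely additive
   probability other than mu; so uniqueness forces uniform convergence.  As a
   setwise limit of countably additive probabilities, mu is countably additive.
   Applying the uniform convergence to a union of bad sets E_n with summable masses
   shows that A_m(x, E) is uniformly small when mu(E) is small; invariance of mu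
   transfers this to a single power: P^m 1_E <= e as soon as mu(E) <= delta, which
   gives (D) and (D~).  For (K), averaging over the cells of a fine enough finite
   partition (with respect to mu) changes each P^(2m)(x, .) by at most 1/2 in
   variation, so that A^(2m) is within 1/2 of a finite rank operator. *)
Require Import Defs.
From HB Require Import structures.
From mathcomp Require Import all_boot all_order all_algebra.
From mathcomp Require Import all_classical all_reals all_analysis.
From mathcomp Require Import finmap measurable_realfun.
From mathcomp Require Import zify ring lra.

Set Implicit Arguments.
Unset Strict Implicit.
Unset Printing Implicit Defensive.

Import Order.TTheory GRing.Theory Num.Theory.
Import numFieldNormedType.Exports.
Import HBSimple.

Local Open Scope classical_set_scope.
Local Open Scope ring_scope.

(** * Bounded functionals on bounded measurable functions *)

Section bounded_functionals.
Context d (T : measurableType d) (R : realType).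
Implicit Types (f g : T -> R) (L : (T -> R) -> R).

Definition bounded_measurable f :=
  measurable_fun setT f /\ exists M, forall x, `|f x| <= M.

Lemma bounded_measurable_cst (c : R) : bounded_measurable (cst c).
Proof. by split; [exact: measurable_cst|exists `|c|]. Qed.

Lemma bounded_measurableD f g : bounded_measurable f -> bounded_measurable g ->
  bounded_measurable (fun x => f x + g x).
Proof.
move=> [mf [M fM]] [mg [N gN]]; split; first exact: measurable_funD.
by exists (M + N) => x; apply: le_trans (ler_normD _ _) _; rewrite lerD.
Qed.

Lemma bounded_measurableZ (a : R) f : bounded_measurable f ->
  bounded_measurable (fun x => a * f x).
Proof.
move=> [mf [M fM]]; split; first exact: measurable_funM.
by exists (`|a| * M) => x; rewrite normrM ler_wpM2l.
Qed.

Lemma bounded_measurableB f g : bounded_measurable f -> bounded_measurable g ->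
  bounded_measurable (fun x => f x - g x).
Proof.
move=> bf bg; rewrite (_ : (fun x => _) = fun x => f x + (-1) * g x).
  exact/bounded_measurableD/bounded_measurableZ.
by apply/funext => x; rewrite mulN1r.
Qed.

Lemma bounded_measurable_norm f : bounded_measurable f ->
  bounded_measurable (fun x => `|f x|).
Proof.
move=> [mf [M fM]]; split; first exact: measurableT_comp.
by exists M => x; rewrite normr_id.
Qed.

Lemma bounded_measurable_sum (I : Type) (s : seq I) (f : I -> T -> R) :
  (forall i, bounded_measurable (f i)) ->
  bounded_measurable (fun x => \sum_(i <- s) f i x).
Proof.
move=> bf; split; first by apply: measurable_sum => i; have [] := bf i.
elim: s => [|i s [M IH]]; first by exists 0 => x; rewrite big_nil normr0.
have [_ [N fN]] := bf i; exists (N + M) => x; rewrite big_cons.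
by apply: le_trans (ler_normD _ _) _; rewrite lerD.
Qed.

Lemma bounded_measurable_indic (E : set T) : measurable E ->
  bounded_measurable (\1_E).
Proof.
move=> mE; split; first exact: measurable_indic.
by exists 1 => x; rewrite indicE; case: (_ \in _); rewrite ?normr1 ?normr0.
Qed.

Lemma bounded_measurable_sfun (s : {sfun T >-> R}) : bounded_measurable s.
Proof.
split; first exact: measurable_funP.
rewrite (_ : (s : T -> R) = fun x => \sum_(r <- fset_set (range s)) r * \1_(s @^-1` [set r]) x).
  apply: (bounded_measurable_sum _ _).2 => r.
  exact/bounded_measurableZ/bounded_measurable_indic.
apply/funext => x; rewrite fimfunE fsbig_finite//=.
Qed.

(** The affine map [(f + N) / (2 * N)] brings the range into [0, 1], where [uniformly_simple01]
    applies with precision [e / (2 * N)]; undoing the map restores the precision [e]. *)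
Lemma bounded_measurable_uniformly_simple f :
  bounded_measurable f -> uniformly_simple f.
Proof.
move=> [mf [M fM]] e e0.
pose N := `|M| + 1; have N0 : 0 < N by rewrite ltr_wpDl.
have fN x : - N <= f x <= N.
  rewrite -ler_norml (le_trans (fM x))// /N.
  by have := ler_norm M; lra.
pose h x := (2 * N)^-1 * (f x + N).
have N20 : 0 < 2 * N by rewrite mulr_gt0.
have mh : measurable_fun setT h by apply: measurable_funM => //; exact: measurable_funD.
have h01 x : 0 <= h x <= 1.
  have /andP[? ?] := fN x.
  by rewrite /h mulr_ge0 ?invr_ge0 ?(ltW N20)//= 1?ler_pdivrMl //; lra.
have e'0 : 0 < e / (2 * N) by rewrite divr_gt0.
have [s sh] := uniformly_simple01 mh h01 e'0.
pose c a : {sfun T >-> R} := cst_sfun a.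
exists (c (2 * N) * s + c (- N)) => x.
change (`|2 * N * s x + - N - f x| <= e).
rewrite (_ : _ - f x = 2 * N * (s x - h x)).
  by rewrite normrM gtr0_norm// -ler_pdivlMl// mulrC.
by rewrite /h mulrBr mulVKf ?gt_eqF//; lra.
Qed.

(** A common interface for finitely additive integrals, iterates evaluated at a point, Cesaro means
    and ultrafilter limits; [K] bounds the norm of [L] dual to the sup-norm. *)
Record bounded_functional (K : R) L : Prop := {
  blfD : forall f g, bounded_measurable f -> bounded_measurable g ->
    L (fun x => f x + g x) = L f + L g;
  blfZ : forall a f, bounded_measurable f -> L (fun x => a * f x) = a * L f;
  blf_le : forall f k, bounded_measurable f -> (forall x, `|f x| <= k) ->
    `|L f| <= k * K }.

Section bounded_functional_theory.
Variables (K : R) (L : (T -> R) -> R).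
Hypothesis bL : bounded_functional K L.

Lemma blf_ge0 : 0 <= K.
Proof.
rewrite -[K]mul1r; apply: le_trans (normr_ge0 _) (blf_le bL (f := cst 1) _ _).
  exact: bounded_measurable_cst.
by move=> x; rewrite normr1.
Qed.

Lemma blfB f g : bounded_measurable f -> bounded_measurable g ->
  L (fun x => f x - g x) = L f - L g.
Proof.
move=> bf bg; rewrite (_ : (fun x => _) = fun x => f x + (-1) * g x).
  rewrite (blfD bL)// ?(blfZ bL)// ?mulN1r//.
  exact: bounded_measurableZ.
by apply/funext => x; rewrite mulN1r.
Qed.

Lemma blf_sum (I : Type) (s : seq I) (f : I -> T -> R) :
  (forall i, bounded_measurable (f i)) ->
  L (fun x => \sum_(i <- s) f i x) = \sum_(i <- s) L (f i).
Proof.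
move=> bf; elim: s => [|i s IH].
  rewrite big_nil (_ : (fun x => _) = fun x => 0 * (cst 0 : T -> R) x).
    by rewrite (blfZ bL) ?mul0r//; exact: bounded_measurable_cst.
  by apply/funext => x; rewrite big_nil mul0r.
rewrite big_cons -IH -(blfD bL)//; last exact: bounded_measurable_sum.
by congr L; apply/funext => x; rewrite big_cons.
Qed.

Lemma blf_indicD A B : measurable A -> measurable B -> A `&` B = set0 ->
  L \1_(A `|` B) = L \1_A + L \1_B.
Proof.
move=> mA mB AB; rewrite -(blfD bL); try exact: bounded_measurable_indic.
congr L; apply/funext => x; rewrite !indicE in_setU.
have := in_set0 x; rewrite -AB in_setI.
by case: (x \in A); case: (x \in B) => //=; rewrite ?addr0 ?add0r.
Qed.

Lemma blf_simple (nu : set T -> R) (s : {sfun T >-> R}) :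
  (forall E, measurable E -> nu E = L \1_E) -> simple_integral nu s = L s.
Proof.
move=> nuL; rewrite /simple_integral fsbig_finite//=.
have -> : L s = L (fun x => \sum_(r <- fset_set (range s)) r * \1_(s @^-1` [set r]) x).
  by congr L; apply/funext => x; rewrite fimfunE fsbig_finite.
rewrite blf_sum => [|r]; last exact/bounded_measurableZ/bounded_measurable_indic.
by apply: eq_bigr => r _; rewrite (blfZ bL) ?nuL//; exact/bounded_measurable_indic.
Qed.

(** [L] agrees with [simple_integral nu] on simple functions and is Lipschitz for the sup-norm, so
    [L f] has the defining property of the integral. Identities between integrals thus reduce to
    indicators. *)
Lemma ba_integral_blf (nu : ba T R) f :
  (forall E, measurable E -> nu E = L \1_E) -> bounded_measurable f ->
  ba_integral nu f = L f.
Proof.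
move=> nuL bf; apply: ba_integralP.
- exact: bounded_measurable_uniformly_simple.
- move=> e e0; have K0 := blf_ge0; have K1 : 0 < K + 1 by lra.
  exists (e / (K + 1)); first by rewrite divr_gt0.
  move=> s sf; rewrite (blf_simple s nuL) -blfB//; last exact: bounded_measurable_sfun.
  apply: (@le_lt_trans _ _ (e / (K + 1) * K)).
    apply: (blf_le bL) => [|x]; last exact: ltW.
    exact/bounded_measurableB/bf/bounded_measurable_sfun.
  by rewrite mulrAC ltr_pdivrMr// ltr_pM2l//; lra.
Qed.

End bounded_functional_theory.

Lemma ba_integral_indic (mu : ba T R) E : measurable E ->
  ba_integral mu \1_E = mu E.
Proof.
move=> mE.
(* The indicator is itself simple, so the approximation bound with [k = 0] becomes an equality. *)
have /eqP <- : simple_integral mu (indic_sfun _ mE) == ba_integral mu \1_E.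
  rewrite -subr_eq0 -normr_le0 -(mul0r (tv_norm mu)); apply: ba_integral_approx.
  - exact: ba_additive.
  - exact: ba_bounded.
  - exact/bounded_measurable_uniformly_simple/bounded_measurable_indic.
  - by move=> x; rewrite /= subrr normr0.
rewrite (@simple_integralE _ _ _ _ (@ba_additive _ _ _ mu) _ bool
  (fun b => if b then E else ~` E) (fun b => b%:R)).
- by rewrite big_bool/= mul1r mul0r addr0.
- by case => //; exact: measurableC.
- by apply/trivIsetP => -[] [] _ _ //= _; rewrite ?setICr ?setICl.
- rewrite -subTset => x _; have [Ex|nEx] := pselect (E x).
    by exists true.
  by exists false.
- by case=> x Ex; rewrite /= /mindic indicE; [rewrite mem_set|rewrite memNset].
Qed.

Lemma ba_integralZ (mu : ba T R) a f : bounded_measurable f ->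
  ba_integral mu (fun x => a * f x) = a * ba_integral mu f.
Proof.
move=> bf; have usf := bounded_measurable_uniformly_simple bf.
have [->|a0] := eqVneq a 0.
  rewrite mul0r.
  suff : `|ba_integral mu (fun x => 0 * f x)| <= 0 * tv_norm mu.
    by rewrite mul0r normr_le0 => /eqP.
  apply: ba_integral_le.
  - exact: ba_additive.
  - exact: ba_bounded.
  - exact/bounded_measurable_uniformly_simple/bounded_measurableZ.
  - by move=> x; rewrite mul0r normr0.
have V0 := tv_norm_ge0 (@ba_additive _ _ _ mu) (@ba_bounded _ _ _ mu).
apply/eqP; rewrite -subr_eq0 -normr_le0; apply/ler_addgt0Pr => e e0; rewrite add0r.
(* With this [k], each of the two comparisons below costs at most [e / 2] after scaling by [a]. *)
pose k := e / (2 * `|a| * (tv_norm mu + 1)).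
have k0 : 0 < k by rewrite divr_gt0// !mulr_gt0 ?normr_gt0//; lra.
have [s sf] := usf _ k0.
have h1 := ba_integral_approx (@ba_additive _ _ _ mu) (@ba_bounded _ _ _ mu) usf sf.
have := @ba_integral_approx _ _ _ _ (@ba_additive _ _ _ mu) (@ba_bounded _ _ _ mu)
  (fun x => a * f x) (cst_sfun a * s) (`|a| * k)
  (bounded_measurable_uniformly_simple (bounded_measurableZ a bf)).
have -> : simple_integral mu (cst_sfun a * s) = a * simple_integral mu s.
  have [n [E [b [c [mE tE cE sE aE]]]]] := simple_common_partition s (cst_sfun a * s).
  rewrite (simple_integralE (@ba_additive _ _ _ mu) mE tE cE sE).
  rewrite (simple_integralE (c := fun i => a * b i) (@ba_additive _ _ _ mu) mE tE cE).
    by rewrite mulr_sumr; apply: eq_bigr => i _; rewrite mulrA.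
  by move=> i x Eix; rewrite sfunM/= (sE _ _ Eix).
move=> h2; have {}h2 : `|a * simple_integral mu s - ba_integral mu (fun x => a * f x)|
    <= `|a| * k * tv_norm mu.
  apply: h2 => x; change (`|a * s x - a * f x| <= `|a| * k).
  by rewrite -mulrBr normrM ler_wpM2l.
have h3 : `|a * simple_integral mu s - a * ba_integral mu f| <= `|a| * k * tv_norm mu.
  by rewrite -mulrBr normrM -mulrA ler_wpM2l.
have h4 : `|a| * k * tv_norm mu <= e / 2.
  rewrite (_ : `|a| * k * tv_norm mu = (e / 2) * (tv_norm mu / (tv_norm mu + 1))).
    rewrite ler_piMr ?divr_ge0 ?(ltW e0)// ler_pdivrMr; lra.
  by rewrite /k; field; rewrite normr_eq0 a0/= andbT gt_eqF//; lra.
move: h2 h3 => /ler_normlP[? ?] /ler_normlP[? ?].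
by apply/ler_normlP; split; lra.
Qed.

Lemma bounded_functional_ba_integral (mu : ba T R) :
  bounded_functional `|mu| (ba_integral mu).
Proof.
split=> [f g bf bg|a f|f k bf fk]; last 1 first.
- apply: ba_integral_le fk; [exact: ba_additive|exact: ba_bounded|].
  exact: bounded_measurable_uniformly_simple.
- rewrite -ba_integralD//; try exact: bounded_measurable_uniformly_simple.
  + exact: ba_additive.
  + exact: ba_bounded.
- exact: ba_integralZ.
Qed.

(* Positivity is automatic: if `0 <= f <= M`, then `|L (f - M / 2)| <= M / 2`. *)
Record mean L : Prop := {
  mean_blf : bounded_functional 1 L;
  mean1 : L (cst 1) = 1 }.

Section mean_theory.
Variable L : (T -> R) -> R.
Hypothesis mL : mean L.
Let bL := mean_blf mL.

Lemma mean_cst c : L (cst c) = c.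
Proof.
rewrite (_ : cst c = fun x => c * (cst 1 : T -> R) x).
  by rewrite (blfZ bL) ?(mean1 mL) ?mulr1//; exact: bounded_measurable_cst.
by apply/funext => x; rewrite /= mulr1.
Qed.

Lemma mean_ge0 f : bounded_measurable f -> (forall x, 0 <= f x) -> 0 <= L f.
Proof.
move=> bf f0; have [_ [M fM]] := bf.
have : `|L (fun x => f x - M / 2)| <= M / 2 * 1.
  apply: (blf_le bL).
    exact/bounded_measurableB/bounded_measurable_cst.
  move=> x; have := f0 x; have := fM x => /ler_normlP[? ?] ?.
  by apply/ler_normlP; split; lra.
rewrite (blfB bL)//; last exact: bounded_measurable_cst.
rewrite (mean_cst (M / 2)) mulr1.
by move=> /ler_normlP[? ?]; lra.
Qed.

Lemma mean_le f g : bounded_measurable f -> bounded_measurable g ->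
  (forall x, f x <= g x) -> L f <= L g.
Proof.
move=> bf bg fg; rewrite -subr_ge0 -(blfB bL)//.
apply: mean_ge0 => [|x]; first exact: bounded_measurableB.
by rewrite subr_ge0.
Qed.

Lemma mean_norm_le f : bounded_measurable f -> `|L f| <= L (fun x => `|f x|).
Proof.
move=> bf; have bf' := bounded_measurable_norm bf.
apply/ler_normlP; split; last first.
  by apply: mean_le => // x; exact: ler_norm.
rewrite -mulN1r -(blfZ bL)//; apply: mean_le => //.
  exact: bounded_measurableZ.
by move=> x; rewrite mulN1r -normrN; exact: ler_norm.
Qed.

Lemma mean_indic01 E : measurable E -> 0 <= L \1_E <= 1.
Proof.
move=> mE; have bE := bounded_measurable_indic mE.
rewrite mean_ge0//=.
suff : L \1_E <= L (cst 1) by rewrite (mean1 mL).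
apply: mean_le => //; first exact: bounded_measurable_cst.
by move=> x; rewrite indicE /=; case: (_ \in _); rewrite ?lexx ?ler01.
Qed.

Lemma mean_indicS A B : measurable A -> measurable B -> A `<=` B ->
  L \1_A <= L \1_B.
Proof.
move=> mA mB AB; apply: mean_le; try exact: bounded_measurable_indic.
move=> x; rewrite !indicE; have [xA|xA] := boolP (x \in A); last by rewrite ler0n.
by rewrite (mem_set (AB _ (set_mem xA))).
Qed.

(** Markov's inequality, from the pointwise bound of [c] times the indicator by [f]. *)
Lemma mean_markov f c : bounded_measurable f -> (forall x, 0 <= f x) -> 0 < c ->
  c * L \1_[set x | c <= f x] <= L f.
Proof.
move=> bf f0 c0; have mE : measurable [set x | c <= f x].
  rewrite -[X in measurable X]setTI; apply: measurable_fun_le => //.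
  by case: bf.
have bE := bounded_measurable_indic mE.
rewrite -(blfZ bL)//; apply: mean_le => //; first exact: bounded_measurableZ.
by move=> x; rewrite indicE; have [/set_mem|_] := boolP (x \in _); rewrite ?mulr1 ?mulr0.
Qed.

End mean_theory.

End bounded_functionals.

(** * The Markov operator on functions *)

Section transition.
Context d (T : measurableType d) (R : realType).
Variable p : R.-pker T ~> T.
Implicit Types (f g : T -> R) (mu : ba T R).

Lemma mean_comp (L : (T -> R) -> R) (Q : (T -> R) -> T -> R) :
  mean L -> (forall x, mean (Q ^~ x)) ->
  (forall f, bounded_measurable f -> bounded_measurable (Q f)) ->
  mean (fun f => L (Q f)).
Proof.
move=> mL mQ bQ; have bL := mean_blf mL; split; first split.
- move=> f g bf bg; rewrite -(blfD bL); try exact: bQ.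
  by congr L; apply/funext => x; rewrite (blfD (mean_blf (mQ x))).
- move=> a f bf; rewrite -(blfZ bL); last exact: bQ.
  by congr L; apply/funext => x; rewrite (blfZ (mean_blf (mQ x))).
- move=> f k bf fk; apply: (blf_le bL); first exact: bQ.
  by move=> x; rewrite -[k]mulr1; exact: (blf_le (mean_blf (mQ x))).
- rewrite (_ : Q (cst 1) = cst 1) ?(mean1 mL)//.
  by apply/funext => x; rewrite (mean1 (mQ x)).
Qed.

Definition transition f : T -> R := fun x => \int[p x]_y f y.

Lemma integrable_pker f x :
  bounded_measurable f -> (p x).-integrable setT (EFin \o f).
Proof.
move=> [mf [M fM]]; apply: measurable_bounded_integrable => //.
  by rewrite prob_kernel ltry.
exists M; split; first exact: num_real.
by move=> N MN y _; apply: le_trans (fM y) (ltW MN).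
Qed.

Lemma transition_cst (c : R) x : transition (cst c) x = c.
Proof.
by rewrite /transition Rintegral_cst// prob_kernel mulr1.
Qed.

Lemma mean_transition x : mean (transition ^~ x).
Proof.
split; last exact: transition_cst.
split=> [f g bf bg|a f bf|f k bf fk].
- by rewrite /transition RintegralD//; exact: integrable_pker.
- by rewrite /transition RintegralZl//; exact: integrable_pker.
- rewrite mulr1 /transition; apply: le_trans (le_normr_Rintegral _ _) _ => //.
    exact: integrable_pker.
  rewrite -[leRHS](transition_cst k x); apply: le_Rintegral => //.
  + exact/integrable_pker/bounded_measurable_norm.
  + exact/integrable_pker/bounded_measurable_cst.
Qed.

Lemma bounded_measurable_transition f :
  bounded_measurable f -> bounded_measurable (transition f).
Proof.
move=> bf; have [mf [M fM]] := bf.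
(* Adding [M] makes the integrand nonnegative, so that measurability of kernel integrals applies;
   [M] is subtracted again afterwards. *)
have bfM : bounded_measurable (fun x => f x + M).
  exact/bounded_measurableD/bounded_measurable_cst.
split; last first.
  by exists M => x; rewrite -[M]mulr1; exact: (blf_le (mean_blf (mean_transition x))).
rewrite (_ : transition f = fun x => transition (fun y => f y + M) x - M); last first.
  apply/funext => x; have bL := mean_blf (mean_transition x).
  rewrite (blfD bL)//; last exact: bounded_measurable_cst.
  by rewrite (transition_cst M x) addrK.
apply: measurable_funB => //; apply: measurableT_comp => //.
apply: (measurable_fun_integral_kernel (l := p)) => [U mU|z|].
- exact: measurable_kernel.
- by rewrite lee_fin; have := fM z => /ler_normlP[]; lra.
- by apply/measurable_EFinP; case: bfM.
Qed.

Lemma bounded_measurable_iter k f :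
  bounded_measurable f -> bounded_measurable (iter k transition f).
Proof. by move=> bf; elim: k => //= k; exact: bounded_measurable_transition. Qed.

Lemma mean_iter k x : mean (fun f => iter k transition f x).
Proof.
elim: k x => [|k IH] x.
  by split=> //; split=> //= f k _; rewrite mulr1.
apply: (mean_comp (Q := iter k transition) (mean_transition x)) => // f.
exact: bounded_measurable_iter.
Qed.

Lemma iter_kernelE k x E : measurable E ->
  iter_kernel p k x E = (iter k transition \1_E x)%:E.
Proof.
move=> mE; elim: k x => [|k IH] x /=; first by rewrite diracE indicE.
under eq_integral do rewrite IH.
rewrite /transition /Rintegral fineK//.
apply: integral_fune_fin_num => //; apply: integrable_pker.
exact/bounded_measurable_iter/bounded_measurable_indic.
Qed.

(** Dominated convergence under each [p x], iterated: the bound [M] survives every step because [P]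
    is a contraction. *)
Lemma iter_transition_cvg0 k (f : nat -> T -> R) (M : R) :
  (forall n, bounded_measurable (f n)) -> (forall n x, `|f n x| <= M) ->
  (forall x, f n x @[n --> \oo] --> (0 : R)) ->
  forall x, iter k transition (f n) x @[n --> \oo] --> (0 : R).
Proof.
move=> bf fM f0; elim: k => [//|k IH] x /=.
pose h n := iter k transition (f n).
have bh n : bounded_measurable (h n) by exact: bounded_measurable_iter.
rewrite /transition /Rintegral; apply: fine_cvg.
have -> : (0%:E = \int[p x]_y cst 0 y :> \bar R)%E by rewrite integral0.
apply: (@dominated_cvg _ _ _ (p x) setT measurableT (fun n y => (h n y)%:E) (cst 0%E)
  (cst M%:E)).
- by move=> n; apply/measurable_EFinP; case: (bh n).
- by move=> y _; apply/cvg_EFin; [exact: nearW|exact: IH].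
- by [].
- exact/integrable_pker/bounded_measurable_cst.
- move=> n y _ /=; rewrite lee_fin -[M]mulr1.
  exact: (blf_le (mean_blf (mean_iter k y))).
Qed.

Lemma transition_indic x E : measurable E -> transition \1_E x = fine (p x E).
Proof.
by move=> mE; rewrite -(iter_kernel1 p x mE) (iter_kernelE 1).
Qed.

Lemma ba_integral_markov mu f : bounded_measurable f ->
  ba_integral (Defs.markov p mu) f = ba_integral mu (transition f).
Proof.
have bI := bounded_functional_ba_integral mu.
have bL : bounded_functional `|mu| (fun f => ba_integral mu (transition f)).
  split=> [g h bg bh|a g bg|g k bg gk].
  - rewrite -(blfD bI); try exact: bounded_measurable_transition.
    congr ba_integral; apply/funext => x.
    by rewrite (blfD (mean_blf (mean_transition x))).
  - rewrite -(blfZ bI); last exact: bounded_measurable_transition.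
    congr ba_integral; apply/funext => x.
    by rewrite (blfZ (mean_blf (mean_transition x))).
  - apply: (blf_le bI); first exact: bounded_measurable_transition.
    by move=> x; rewrite -[k]mulr1; exact: (blf_le (mean_blf (mean_transition x))).
move=> bf; apply: (ba_integral_blf bL) => // E mE; rewrite markovE//.
by congr ba_integral; apply/funext => x; rewrite transition_indic.
Qed.

Lemma ba_integral_iter_markov k mu f : bounded_measurable f ->
  ba_integral (iter k (Defs.markov p) mu) f = ba_integral mu (iter k transition f).
Proof.
elim: k mu f => [//|k IH] mu f bf; rewrite iterSr IH// ba_integral_markov//.
exact: bounded_measurable_iter.
Qed.

Lemma iter_markov_ca k (mu : ca T R) :
  (iter k (markov_ca p) mu : ba T R) = iter k (Defs.markov p) mu.
Proof. by elim: k => //= k ->. Qed.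

End transition.

(** * Uniform convergence of Cesaro means *)

Section ultrafilter_limits.
Context {R : realType} {I : Type} (U : set_system I) {UU : UltraFilter U}.

(** Compactness of [-M, M] gives a cluster point, and a cluster point of an ultrafilter is a limit:
    for each neighbourhood, either it or its complement is in the filter, and the latter is
    excluded. *)
Lemma ultra_bounded_cvg (u : I -> R) (M : R) :
  (forall i, `|u i| <= M) -> cvg (u @ U).
Proof.
move=> uM; have PU := @ultra_proper _ U UU.
have UM : (u @ U) `[- M, M]%classic.
  by rewrite /nbhs /=; apply: filterE => i /=; rewrite in_itv /= -ler_norml; exact: uM.
have [l [_ Ul]] := @segment_compact R (- M) M (u @ U) _ UM.
apply/cvg_ex; exists l => A lA.
have [//|UnA] := in_ultra_setVsetC (u @^-1` A) UU.
by have [x []] := Ul (~` A) A UnA lA.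
Qed.

End ultrafilter_limits.

Section uniform_mean_ergodicity.
Context d (T : measurableType d) (R : realType).
Implicit Types (f g : T -> R) (mu nu : ba T R).

Lemma ba_norm_ge0E mu : (forall E, measurable E -> 0 <= mu E) -> `|mu| = mu setT.
Proof.
move=> mu0; apply/eqP; rewrite eq_le; apply/andP; split; last first.
  by rewrite -[leLHS]ger0_norm ?mu0//; exact: ba_le_variation.
rewrite ba_normE; apply: ge_sup; first exact: partition_sums_neq0.
move=> _ [n [E [mE tE cE ->]]].
rewrite (eq_bigr (fun i => mu (E i))) => [|i _]; last by rewrite ger0_norm ?mu0.
rewrite -(fin_additive_big (@ba_additive _ _ _ mu))// -cE.
rewrite (_ : \big[setU/set0]_(i < n) E i = \bigcup_i E i)//.
rewrite -bigcup_seq; apply/seteqP; split=> x [i _ Eix]; exists i => //=.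
exact: mem_index_enum.
Qed.

Lemma S_baT mu : S_ba mu -> mu setT = 1.
Proof. by move=> [mu0 mu1]; rewrite -ba_norm_ge0E. Qed.

Lemma mean_ba_integral mu : S_ba mu -> mean (ba_integral mu).
Proof.
move=> Smu; split.
  by have [_ <-] := Smu; exact: bounded_functional_ba_integral.
rewrite -[RHS](S_baT Smu) -ba_integral_indic//; congr ba_integral.
by apply/funext => x; rewrite indicE in_setT.
Qed.

(** The values of [L] on indicators form a finitely additive probability, and [ba_integral_blf]
    extends the agreement to bounded measurable functions. *)
Lemma mean_representation (L : (T -> R) -> R) : mean L ->
  exists2 nu : ba T R, S_ba nu &
    forall f, bounded_measurable f -> ba_integral nu f = L f.
Proof.
move=> mL; pose m E := if `[< measurable E >] then L \1_E else 0.
have mE E : measurable E -> m E = L \1_E by move=> mE; rewrite /m asboolT.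
have mba : m \in @is_ba d T R.
  apply/asboolP; split=> [E nE|A B mA mB AB|].
  - by rewrite /m asboolF.
  - by rewrite !mE ?(blf_indicD (mean_blf mL))//; exact: measurableU.
  - exists 1 => E /[dup] mE' /mE ->.
    by have /andP[? ?] := mean_indic01 mL mE'; rewrite ger0_norm.
exists (Ba mba); last first.
  by move=> f bf; exact: (@ba_integral_blf _ _ _ _ _ (mean_blf mL) (Ba mba) f mE bf).
have m0 E : measurable E -> 0 <= m E.
  by move=> /[dup] mE' /mE ->; have /andP[] := mean_indic01 mL mE'.
split=> //; rewrite ba_norm_ge0E//= mE// -[RHS](mean1 mL); congr L.
by apply/funext => x; rewrite indicE in_setT.
Qed.

Variable p : R.-pker T ~> T.

(** The exponents run from 1 to [n], as in condition (D~). For [n = 0] the value is 0, so averages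
    that must be means are taken at [n.+1]. *)
Definition cesaro_avg n f x : R := n%:R^-1 * \sum_(k < n) iter k.+1 (transition p) f x.

Lemma mean_cesaro n x : mean (cesaro_avg n.+1 ^~ x).
Proof.
have mI k := mean_iter p k x.
split; first split=> [f g bf bg|a f bf|f k bf fk].
- rewrite /cesaro_avg -mulrDr -big_split/=; congr (_ * _); apply: eq_bigr => k _.
  exact: (blfD (mean_blf (mI k.+1))).
- rewrite /cesaro_avg mulrCA; congr (_ * _); rewrite mulr_sumr; apply: eq_bigr => k _.
  exact: (blfZ (mean_blf (mI k.+1))).
- rewrite /cesaro_avg normrM ger0_norm ?invr_ge0 ?ler0n// mulr1 ler_pdivrMl ?ltr0n//.
  rewrite mulr_natl -[n.+1 in leRHS]card_ord -sumr_const.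
  apply: le_trans (ler_norm_sum _ _ _) _; apply: ler_sum => i _.
  by rewrite -[leRHS]mulr1; exact: (blf_le (mean_blf (mI i.+1))).
- rewrite /cesaro_avg (eq_bigr (fun=> 1)) => [|k _]; last exact: (mean1 (mI k.+1)).
  by rewrite sumr_const card_ord mulVf// pnatr_eq0.
Qed.

(** The difference telescopes to the last iterate minus the first, each bounded by [M]. *)
Lemma cesaro_transition n f x (M : R) : bounded_measurable f ->
  (forall y, `|f y| <= M) ->
  `|cesaro_avg n.+1 (transition p f) x - cesaro_avg n.+1 f x| <= 2 * M / n.+1%:R.
Proof.
move=> bf fM; rewrite /cesaro_avg -mulrBr normrM ger0_norm ?invr_ge0 ?ler0n// mulrC.
rewrite ler_pM2r ?invr_gt0 ?ltr0n// -sumrB.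
pose u k := iter k.+1 (transition p) f x.
rewrite (eq_bigr (fun k : 'I_n.+1 => u k.+1 - u k)).
  rewrite -(big_mkord xpredT (fun k => u k.+1 - u k)).
  rewrite telescope_sumr// mulrDl !mul1r.
  apply: le_trans (ler_normB _ _) _.
  by apply: lerD; rewrite -[leRHS]mulr1; exact: (blf_le (mean_blf (mean_iter p _ x))).
by move=> k _; rewrite /u -iterSr.
Qed.

Lemma cesaro_uniform_cvg mu : Delta_ba p = [set mu] ->
  forall E (e : R), measurable E -> 0 < e ->
  exists N, forall n x, (N <= n)%N -> `|cesaro_avg n.+1 \1_E x - mu E| <= e.
Proof.
move=> Dmu E e mE e0; apply: contrapT => ncvg.
(* Failure of uniformity yields, for each [N], a bad time past [N] together with a bad starting
   point. *)
have /choice[nx nxP] : forall N, exists nx : nat * T,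
    (N <= nx.1)%N /\ e < `|cesaro_avg nx.1.+1 \1_E nx.2 - mu E|.
  move=> N; apply: contrapT => h; apply: ncvg; exists N => n x Nn.
  by rewrite leNgt; apply/negP => he; apply: h; exists (n, x).
(* An ultrafilter refining the filter at infinity makes every bounded sequence converge, giving one
   linear limit [L] for all [f] at once. *)
have [U [UU Uoo]] := @ultraFilterLemma nat \oo _.
have PU := @ultra_proper _ U UU.
pose C i f := cesaro_avg (nx i).1.+1 f (nx i).2.
have mC i : mean (C i) := mean_cesaro _ _.
pose L f := lim (C ^~ f @ U).
have CL f : bounded_measurable f -> C ^~ f @ U --> L f.
  move=> /[dup] bf [_ [M fM]]; apply: (@ultra_bounded_cvg _ _ _ _ _ M) => i.
  by rewrite -[M]mulr1; exact: (blf_le (mean_blf (mC i))).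
have mL : mean L.
  split; first split=> [f g bf bg|a f bf|f k bf fk].
  - apply: cvg_lim => //; rewrite (_ : C ^~ _ = fun i => C i f + C i g).
      by apply: cvgD; exact: CL.
    by apply/funext => i; exact: (blfD (mean_blf (mC i))).
  - apply: cvg_lim => //; rewrite (_ : C ^~ _ = fun i => a * C i f).
      by apply: cvgMr; exact: CL.
    by apply/funext => i; exact: (blfZ (mean_blf (mC i))).
  - have Ck i : `|C i f| <= k by rewrite -[k]mulr1; exact: (blf_le (mean_blf (mC i))).
    rewrite mulr1; apply/ler_normlP; split; last first.
      apply: limr_le; first by apply/cvg_ex; exists (L f); exact: CL.
      by apply: filterE => i; have /ler_normlP[] := Ck i.
    rewrite lerNl; apply: limr_ge; first by apply/cvg_ex; exists (L f); exact: CL.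
    by apply: filterE => i; have /ler_normlP[] := Ck i; rewrite lerNl.
  - apply: cvg_lim => //; rewrite (_ : C ^~ _ = cst 1); first exact: cvg_cst.
    by apply/funext => i; exact: (mean1 (mC i)).
(* [L] is invariant since the [i]-th bad time is at least [i]: the telescoping error is at most
   [2 * M / i.+1]. *)
have LP f : bounded_measurable f -> L (transition p f) = L f.
  move=> /[dup] bf [_ [M fM]]; apply/eqP; rewrite -subr_eq0; apply/eqP.
  pose D i := C i (transition p f) - C i f.
  have D1 : D @ U --> L (transition p f) - L f.
    by apply: cvgB; apply: CL => //; exact: bounded_measurable_transition.
  rewrite -(cvg_lim (@norm_hausdorff _ _) D1).
  apply: (cvg_lim (@norm_hausdorff _ _)); apply/cvgrPdist_le => r r0.
  have : (2 * M * i.+1%:R^-1) @[i --> \oo] --> (0 : R).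
    by rewrite -[X in _ --> X](mulr0 (2 * M)); apply: cvgMr; exact: cvg_harmonic.
  move/cvgrPdist_le => /(_ _ r0) /Uoo; apply: filterS => i.
  rewrite !sub0r !normrN => hi; apply: le_trans (cesaro_transition _ _ bf fM) _.
  apply: le_trans hi; apply: le_trans _ (ler_norm _).
  have M0 : 0 <= M := le_trans (normr_ge0 _) (fM point).
  rewrite ler_wpM2l ?mulr_ge0// lef_pV2 ?posrE ?ltr0n// ler_nat ltnS.
  by have [] := nxP i.
have [nu Snu nuL] := mean_representation mL.
have : Delta_ba p nu.
  split => //; apply: baP => F mF.
  rewrite -!ba_integral_indic// ba_integral_markov ?nuL ?LP//.
  - exact: bounded_measurable_indic.
  - exact: bounded_measurable_indic.
  - exact/bounded_measurable_transition/bounded_measurable_indic.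
  - exact: bounded_measurable_indic.
(* Uniqueness forces [nu = mu], so [C i \1_E] tends to [mu E] along [U], although every term is more
   than [e] away. *)
rewrite Dmu => numu; have bE := bounded_measurable_indic R mE.
have := CL _ bE; rewrite -nuL// ba_integral_indic// numu.
move=> /cvgrPdist_le/(_ _ e0) h.
have [i] := filter_ex h.
by rewrite distrC leNgt => /negP; apply; have [] := nxP i.
Qed.

End uniform_mean_ergodicity.

(** * Continuity at the empty set *)

Section continuity_at_empty.
Context d (T : measurableType d) (R : realType).
Implicit Types (m : set T -> R) (F : nat -> set T).

(** For finite finitely additive measures this is countable additivity, in a form convenient for
    limits. *)
Definition continuous_at_empty m := forall F,
  (forall n, measurable (F n)) -> (forall i j, (i <= j)%N -> F j `<=` F i) ->
  \bigcap_n F n = set0 -> m (F n) @[n --> \oo] --> (0 : R).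

Lemma fin_additive_le m A B : fin_additive m ->
  (forall E, measurable E -> 0 <= m E) -> measurable A -> measurable B ->
  A `<=` B -> m A <= m B.
Proof.
move=> addm m0 mA mB AB; rewrite -(setDUK AB) addm ?lerDl ?m0//; last exact: setDIK.
- exact: measurableD.
- exact: measurableD.
Qed.

(** The partial sums miss [mu U] by the mass of the tail, and the tails decrease to the empty
    set. *)
Lemma continuous_at_empty_ca (mu : ba T R) :
  continuous_at_empty mu -> mu \in @is_ca d T R.
Proof.
move=> mu0; apply/asboolP => F mF tF mU; set U := \bigcup_n F n in mU *.
pose B n := \big[setU/set0]_(i < n) F i.
have mB n : measurable (B n) by exact: bigsetU_measurable.
have BU n : B n `<=` U by rewrite /B -bigcup_mkord => x [k _ Fkx]; exists k.
have sumE n : \sum_(0 <= i < n) mu (F i) = mu U - mu (U `\` B n).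
  rewrite big_mkord -(fin_additive_big (@ba_additive _ _ _ mu) xpredT (E := fun i : 'I_n => F i))//.
    have -> : mu U = mu (B n) + mu (U `\` B n); last by rewrite addrK.
    by rewrite -ba_additive ?setDUK ?setDIK//; exact: measurableD.
  by apply/trivIsetP => i j _ _ ij; move/trivIsetP : tF; exact.
rewrite (_ : (fun n => _) = EFin \o (fun n => mu U - mu (U `\` B n))).
  apply/cvg_EFin; first exact: nearW.
  rewrite -[X in _ --> X]subr0; apply: cvgB; first exact: cvg_cst.
  apply: mu0 => [n|i j ij|].
  - exact: measurableD.
  - by apply: setDS; exact: subset_bigsetU.
  - rewrite -subset0 => x Tlx; have [[k _ Fkx] _] := Tlx 0%N Logic.I.
    have [_] := Tlx k.+1 Logic.I; apply.
    by rewrite /B -bigcup_mkord; exists k => /=.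
by apply/funext => n /=; rewrite -sumE sumEFin.
Qed.

(* Sliding hump: were `m (F n) >= D > 0` for all `n`, disjoint blocks
   `F (n i) \ F (n i.+1)` would each carry mass close to `D` for arbitrarily late
   `nu k`; the unions of the even and of the odd blocks would then both have
   `m`-mass close to `D` inside a set of `m`-mass close to `D`. *)
Lemma setwise_limit_continuous_at_empty (nu : nat -> set T -> R) m :
  (forall k, fin_additive (nu k)) ->
  (forall k E, measurable E -> 0 <= nu k E) ->
  (forall k, continuous_at_empty (nu k)) ->
  fin_additive m -> (forall E, measurable E -> 0 <= m E) ->
  (forall E, measurable E -> nu k E @[k --> \oo] --> m E) ->
  continuous_at_empty m.
Proof.
move=> addnu nu0 nuc addm m0 num F mF Fni F0.
have mFni i j : (i <= j)%N -> m (F j) <= m (F i).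
  by move=> ij; apply: fin_additive_le => //; exact: Fni.
pose S := [set m (F n) | n in setT]; pose D := inf S.
have lbS : has_lbound S by exists 0 => _ [n _ <-]; exact: m0.
have infS : has_inf S by split => //; exists (m (F 0%N)), 0%N.
have DF n : D <= m (F n) by apply: ge_inf => //; exists n.
have D0 : 0 <= D by apply: lb_le_inf; [exact: infS.1|move=> _ [n _ <-]; exact: m0].
have Deps e : 0 < e -> exists n, m (F n) < D + e.
  by move=> e0; have [_ [n _ <-]] := inf_adherent e0 infS; exists n.
suff : D <= 0.
  move=> D_le0; have D_eq0 : D = 0 by apply/eqP; rewrite eq_le D_le0 D0.
  apply/cvgrPdist_le => e e0; have [N] := Deps _ e0; rewrite D_eq0 add0r => mN.
  exists N => // n /= Nn; rewrite sub0r normrN ger0_norm ?m0//.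
  by apply: le_trans (ltW mN); exact: mFni.
(* Tenths leave enough room: two disjoint unions of mass at least [8 * (D / 10)] cannot fit in
   [F N0], of mass below [11 * (D / 10)]. *)
rewrite leNgt; apply/negP => Dgt0; have D10 : 0 < D / 10 by rewrite divr_gt0.
have [N0 mN0] := Deps _ D10.
(* A state pairs the index of a set with the index of a measure. A late measure gives the current
   set at least nine tenths of [D]; a later set then keeps at most one tenth under that same
   measure. *)
have /choice[step stepP] : forall s : nat * nat, exists s' : nat * nat,
    [/\ (s.1 <= s'.1)%N, (s.2 < s'.2)%N
      & 8 * (D / 10) <= nu s'.2 (F s.1 `\` F s'.1)].
  move=> [n k] /=.
  have /cvgrPdist_le/(_ _ D10)[k1 _ k1P] := num _ (mF n).
  pose k' := maxn k.+1 k1.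
  have nuk' : 9 * (D / 10) <= nu k' (F n).
    have := k1P k' (leq_maxr _ _) => /ler_normlP[_]; have := DF n; lra.
  have /cvgrPdist_le/(_ _ D10)[n1 _ n1P] := nuc k' F mF Fni F0.
  pose n' := maxn n n1; exists (n', k') => /=; split.
  - exact: leq_maxl.
  - exact: leq_maxl.
  - have Fn' : F n' `<=` F n by apply: Fni; exact: leq_maxl.
    have : nu k' (F n') <= D / 10.
      by have := n1P n' (leq_maxr _ _); rewrite /= sub0r normrN => /ler_normlP[].
    have := addnu k' _ _ (mF n') (measurableD (mF n) (mF n')) (setDIK _ _).
    by rewrite setDUK//; lra.
pose s i := iter i step (N0, 0%N).
have s1 i j : (i <= j)%N -> ((s i).1 <= (s j).1)%N.
  move=> ij; rewrite -(subnK ij) addnC; elim: (j - i)%N => [|l IH]; first by rewrite addn0.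
  by rewrite addnS; apply: leq_trans IH _; have [] := stepP (s (i + l)%N).
have s2 i : (i <= (s i).2)%N.
  by elim: i => // i IH; apply: leq_ltn_trans IH _; have [] := stepP (s i).
pose G i := F (s i).1 `\` F (s i.+1).1.
have mG i : measurable (G i) by exact: measurableD.
have GG i j x : (i < j)%N -> G i x -> G j x -> False.
  by move=> ij [_ nF] [Fj _]; apply: nF; exact: Fni (s1 _ _ ij) _ Fj.
pose W b := \bigcup_(i in [set i | odd i = b]) G i.
have mW b : measurable (W b) by apply: bigcup_measurable => i _.
have WF b : W b `<=` F N0.
  by move=> x [i _ [Fx _]]; exact: Fni (s1 0%N i (leq0n i)) _ Fx.
have mWD b : 8 * (D / 10) <= m (W b).
  apply/ler_addgt0Pr => e e0.
  have /cvgrPdist_le/(_ _ e0)[k1 _ k1P] := num _ (mW b).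
  (* A block of parity [b] late enough for its measure to lie in the range where [nu k (W b)] is
     within [e] of its limit. *)
  pose i := (k1.*2 + b)%N.
  have ki : (k1 <= (s i.+1).2)%N.
    by apply: leq_trans (s2 _); rewrite /i -addnn; lia.
  have := k1P _ ki => /ler_normlP[+ _].
  have [_ _] := stepP (s i).
  have : nu (s i.+1).2 (G i) <= nu (s i.+1).2 (W b).
    apply: fin_additive_le => //; first exact: nu0.
    by move=> x Gx; exists i => //=; rewrite /i oddD odd_double; case: (b).
  rewrite /G /=; lra.
have W01 : W true `&` W false = set0.
  rewrite -subset0 => x [[i /= oi Gi] [j /= oj Gj]].
  have [ij|ji|ij] := ltngtP i j; first exact: GG ij Gi Gj.
    exact: GG ji Gj Gi.
  by move: oi; rewrite ij oj.
have : m (W true `|` W false) <= m (F N0).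
  apply: fin_additive_le => //; first exact: measurableU.
  by rewrite subUset; split; exact: WF.
rewrite addm//; have := mWD true; have := mWD false; lra.
Qed.

End continuity_at_empty.

(** * Doeblin's conditions *)

Section doeblin.
Context d (T : measurableType d) (R : realType).
Variables (p : R.-pker T ~> T) (mu : ba T R).
Hypothesis Dmu : Delta_ba p = [set mu].
Let P := transition p.

Let Delta_mu : Delta_ba p mu. Proof. by rewrite Dmu. Qed.
Let Smu : S_ba mu := Delta_mu.1.
Let mu0 : forall E, measurable E -> 0 <= mu E := Smu.1.
Let mmu : mean (ba_integral mu) := mean_ba_integral Smu.
Let addmu : fin_additive mu := @ba_additive _ _ _ mu.

Lemma invariant_integral_iter k f : bounded_measurable f ->
  ba_integral mu (iter k P f) = ba_integral mu f.
Proof.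
move=> bf; elim: k => //= k <-; rewrite -ba_integral_markov ?Delta_mu.2//.
exact: bounded_measurable_iter.
Qed.

Lemma continuous_at_empty_cesaro n x :
  continuous_at_empty (fun E => cesaro_avg p n \1_E x).
Proof.
move=> F mF Fni F0.
have FP y : \1_(F n) y @[n --> \oo] --> (0 : R).
  have [N nFN] : exists N, ~ F N y.
    apply/existsNP => Fy.
    by have : (\bigcap_n F n) y by []; rewrite F0.
  apply/cvgrPdist_le => e e0; exists N => // i /= Ni.
  by rewrite indicE memNset ?subrr ?normr0 ?ltW// => /(Fni _ _ Ni).
rewrite -[X in _ --> X](mulr0 n%:R^-1); apply: cvgMr.
elim: n => [|n IH].
  by rewrite (_ : (fun i => _) = cst 0); [exact: cvg_cst|apply/funext => i; rewrite big_ord0].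
rewrite (_ : (fun i => _) = fun i => \sum_(k < n) iter k.+1 P \1_(F i) x +
    iter n.+1 P \1_(F i) x); last by apply/funext => i; rewrite big_ord_recr.
rewrite -[X in _ --> X]addr0; apply: cvgD => //.
apply: (@iter_transition_cvg0 _ _ _ p n.+1 (fun n => \1_(F n)) 1) => // [i|i y].
  exact: bounded_measurable_indic.
by rewrite ger0_norm indicE; case: (_ \in _); rewrite ?ler01 ?lexx.
Qed.

(** The averages started at one fixed point are countably additive probabilities that converge
    setwise to [mu]. *)
Lemma invariant_continuous_at_empty : continuous_at_empty mu.
Proof.
have mC n := mean_cesaro p n point.
apply: (@setwise_limit_continuous_at_empty _ _ _
  (fun n E => cesaro_avg p n.+1 \1_E point)) => //.
- by move=> n A B mA mB AB; exact: (blf_indicD (mean_blf (mC n))).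
- by move=> n E mE; have /andP[] := mean_indic01 (mC n) mE.
- by move=> n; exact: continuous_at_empty_cesaro.
- move=> E mE; apply/cvgrPdist_le => e e0.
  have [N NP] := cesaro_uniform_cvg Dmu mE e0.
  by exists N => // n /= Nn; rewrite distrC; exact: NP.
Qed.

Definition invariant_ca : ca T R :=
  Ca (continuous_at_empty_ca invariant_continuous_at_empty).

Lemma invariant_setU_le A B : measurable A -> measurable B -> mu (A `|` B) <= mu A + mu B.
Proof.
move=> mA mB; have mBA : measurable (B `\` A) by exact: measurableD.
rewrite (_ : A `|` B = A `|` (B `\` A)); last first.
  by rewrite setDE setUIr setUv setIT.
rewrite addmu ?setDIK// lerD2l; apply: fin_additive_le => //; exact: subDsetl.
Qed.

(** The first [n] sets use at most [c - c / 2 ^+ n] of the geometric budget, and the remaining tail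
    has vanishing mass by continuity at the empty set. *)
Lemma invariant_bigcup_le (E : nat -> set T) (c : R) : (forall n, measurable (E n)) ->
  (forall n, mu (E n) <= c / 2 ^+ n.+1) -> mu (\bigcup_n E n) <= c.
Proof.
move=> mE Ec; set U := \bigcup_n E n.
have mU : measurable U by exact: bigcup_measurable.
pose B n := \big[setU/set0]_(i < n) E i.
have mB n : measurable (B n) by exact: bigsetU_measurable.
have BU n : B n `<=` U by rewrite /B -bigcup_mkord => x [k _ Ekx]; exists k.
have Bc n : mu (B n) <= c - c / 2 ^+ n.
  elim: n => [|n IH]; first by rewrite /B big_ord0 (fin_additive0 addmu) expr0 divr1 subrr.
  rewrite /B big_ord_recr/=; apply: le_trans (invariant_setU_le (mB n) (mE n)) _.
  apply: le_trans (lerD IH (Ec n)) _.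
  have h : c / 2 ^+ n = 2 * (c / 2 ^+ n.+1) by rewrite exprS; field; rewrite expf_neq0.
  by rewrite h; lra.
have c0 : 0 <= c.
  have := le_trans (mu0 (mE 0%N)) (Ec 0%N); rewrite expr1; lra.
apply/ler_addgt0Pr => e e0.
have /cvgrPdist_le/(_ _ e0)[N _ /(_ N (leqnn _))] :
    mu (U `\` B n) @[n --> \oo] --> (0 : R).
  apply: invariant_continuous_at_empty => [n|i j ij|].
  - exact: measurableD.
  - by apply: setDS; exact: subset_bigsetU.
  - rewrite -subset0 => x Ux; have [[k _ Ekx] _] := Ux 0%N Logic.I.
    have [_] := Ux k.+1 Logic.I; apply.
    by rewrite /B -bigcup_mkord; exists k => /=.
rewrite /= sub0r normrN => /ler_normlP[_ muN].
have -> : mu U = mu (B N) + mu (U `\` B N).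
  by rewrite -addmu ?setDUK ?setDIK//; exact: measurableD.
have := Bc N; have : 0 <= c / 2 ^+ N by rewrite divr_ge0// exprn_ge0.
lra.
Qed.

Lemma cesaro_small (e : R) : 0 < e -> exists2 delta, 0 < delta &
  exists n, forall E x, measurable E -> mu E <= delta -> cesaro_avg p n.+1 \1_E x <= e.
Proof.
move=> e0; apply: contrapT => nsmall.
(* These thresholds make the union [U] of all bad sets have mass at most [e / 4]. Uniform
   convergence on [U] then bounds some average of [U] by [e / 2], while the bad set of that index
   pushes it above [e]. *)
have e40 n : 0 < e / 4 / 2 ^+ n.+1 by rewrite !divr_gt0// exprn_gt0.
have /choice[Ex ExP] : forall n, exists Ex : set T * T,
    [/\ measurable Ex.1, mu Ex.1 <= e / 4 / 2 ^+ n.+1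
      & e < cesaro_avg p n.+1 \1_(Ex.1) Ex.2].
  move=> n; apply: contrapT => h; apply: nsmall.
  exists (e / 4 / 2 ^+ n.+1) => //; exists n => E x mE muE.
  by rewrite leNgt; apply/negP => lt_e; apply: h; exists (E, x).
pose U := \bigcup_n (Ex n).1.
have mE n : measurable (Ex n).1 by have [] := ExP n.
have mU : measurable U by exact: bigcup_measurable.
have muU : mu U <= e / 4 by apply: invariant_bigcup_le => // n; have [] := ExP n.
have e40' : 0 < e / 4 by rewrite divr_gt0.
have [N NP] := cesaro_uniform_cvg Dmu mU e40'.
have := NP N (Ex N).2 (leqnn _) => /ler_normlP[_].
have [_ _] := ExP N.
have : cesaro_avg p N.+1 \1_(Ex N).1 (Ex N).2 <= cesaro_avg p N.+1 \1_U (Ex N).2.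
  by apply: (mean_indicS (mean_cesaro p N _)) => // x Ex'; exists N.
lra.
Qed.

Lemma iter_small (e : R) : 0 < e -> exists2 delta, 0 < delta &
  exists n, forall E x, measurable E -> mu E <= delta -> iter n.+1 P \1_E x <= e.
Proof.
move=> e0; have e20 : 0 < e / 2 by rewrite divr_gt0.
have [delta delta0 [n small]] := cesaro_small e20.
have n0 : 0 < n.+1%:R :> R by rewrite ltr0n.
(* By invariance [h] below has integral [n.+1%:R * mu E], so Markov's inequality at level [e / 2]
   gives [mu U <= delta]. *)
exists (delta * (e / 2) / n.+1%:R); first by rewrite divr_gt0// mulr_gt0.
exists n => E x mE muE; have bE := bounded_measurable_indic R mE.
have bI j : bounded_measurable (iter j P \1_E) by exact: bounded_measurable_iter.
have I0 j y : 0 <= iter j P \1_E y by have /andP[] := mean_indic01 (mean_iter p j y) mE.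
pose h y := \sum_(j < n.+1) iter j P \1_E y.
have bh : bounded_measurable h by exact: bounded_measurable_sum.
have h0 y : 0 <= h y by apply: sumr_ge0 => j _; exact: I0.
pose U := [set y | e / 2 <= h y].
have mU : measurable U.
  rewrite -[U]setTI; apply: measurable_fun_le => //.
  by case: bh.
have muU : mu U <= delta.
  have := mean_markov mmu bh h0 e20.
  rewrite -/U ba_integral_indic// (blf_sum (mean_blf mmu))//.
  rewrite (eq_bigr (fun=> mu E)) => [|j _]; last first.
    by rewrite invariant_integral_iter// ba_integral_indic.
  rewrite sumr_const card_ord => /le_trans hU.
  rewrite -(ler_pM2l e20); apply: hU.
  by rewrite -(mulr_natl (mu E)) -ler_pdivlMl// mulrC [e / 2 * _]mulrC.
have EU j y : (j < n.+1)%N -> iter j P \1_E y <= \1_U y + e / 2.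
  move=> jn; rewrite indicE; have [yU|/negP yU] := boolP (y \in U).
    have /andP[_ ?] := mean_indic01 (mean_iter p j y) mE; rewrite /=; lra.
  have {}yU : h y < e / 2 by rewrite ltNge; apply/negP => hy; apply: yU; apply/mem_set.
  rewrite add0r; apply: le_trans (ltW yU).
  by rewrite /h (bigD1 (Ordinal jn))//= lerDl sumr_ge0.
have bU := bounded_measurable_indic R mU.
(* Split the power as [k.+1 + (n - k)] and apply [EU] to the inner factor. The same left side serves
   for every [k], so averaging over [k] brings in the Cesaro mean of [U]. *)
have stepU k : (k < n.+1)%N -> iter n.+1 P \1_E x - e / 2 <= iter k.+1 P \1_U x.
  move=> kn; rewrite lerBlDr -[X in _ + X](mean_cst (mean_iter p k.+1 x)).
  rewrite -(blfD (mean_blf (mean_iter p k.+1 x)))//; last exact: bounded_measurable_cst.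
  rewrite (_ : n.+1 = k.+1 + (n - k))%N ?iterD; last by lia.
  apply: (mean_le (mean_iter p k.+1 x)) => //.
  - exact/bounded_measurableD/bounded_measurable_cst.
  - by move=> y; apply: EU; lia.
have : iter n.+1 P \1_E x - e / 2 <= cesaro_avg p n.+1 \1_U x.
  rewrite /cesaro_avg ler_pdivlMl// mulr_natl -[X in _ *+ X]card_ord -sumr_const.
  by apply: ler_sum => k _; exact: stepU.
have := small U x mU muU; lra.
Qed.

Lemma invariant_condition_D : condition_D p.
Proof.
have h0 : 0 < 2^-1 :> R by rewrite invr_gt0.
have [delta delta0 [n small]] := iter_small h0.
(* One constant plays both roles: it is at most [delta], for the mass threshold, and at most 1/2, so
   that [2^-1 <= 1 - e]. *)
exists invariant_ca, (Num.min delta 2^-1), n.+1; split => //.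
  by rewrite lt_min delta0 h0.
move=> E mE; rewrite le_min => /andP[muE _] x.
rewrite iter_kernelE// lee_fin; apply: le_trans (small _ _ mE muE) _.
have : Num.min delta 2^-1 <= 2^-1 :> R by rewrite ge_min lexx orbT.
lra.
Qed.

Lemma invariant_condition_D_tilde : condition_D_tilde p.
Proof.
have h0 : 0 < 2^-1 :> R by rewrite invr_gt0.
have [delta delta0 [n small]] := cesaro_small h0.
exists invariant_ca, (Num.min delta 2^-1), n.+1; split => //.
  by rewrite lt_min delta0 h0.
move=> E mE; rewrite lt_min => /andP[muE _] x.
rewrite big_add1 succnK big_mkord.
under eq_bigr do rewrite (iter_kernelE _ _.+1)//.
rewrite sumEFin -EFinM lee_fin.
apply: le_trans (small E x mE (ltW muE)) _.
have : Num.min delta 2^-1 <= 2^-1 :> R by rewrite ge_min lexx orbT.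
lra.
Qed.

End doeblin.

(** * Finite rank operators and cell deviations *)

Section finite_rank.
Context {R : realType} {V W : normedModType R}.

(** The image of a bounded set lies in the continuous image of a compact cube of coefficients. *)
Lemma finite_rank_compact (I : finType) (l : I -> V -> R) (w : I -> W) :
  (forall i v, `|l i v| <= `|v|) ->
  compact_operator (fun v => \sum_i l i v *: w i).
Proof.
move=> lv B [M [_ BM]].
have {}BM v : B v -> `|v| <= M + 1.
  by move=> Bv; apply: (BM (M + 1)) => //; rewrite ltrDl ltr01.
pose phi (a : 'rV[R]_#|I|) := \sum_(j < #|I|) a ord0 j *: w (enum_val j).
pose phis s (a : 'rV[R]_#|I|) := \sum_(j <- s) a ord0 j *: w (enum_val j).
have phis_cont s : continuous (phis s).
  elim: s => [|j s IH] a.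
    have -> : phis [::] = cst 0 by apply/funext => b; rewrite /phis big_nil.
    exact: cst_continuous.
  have -> : phis (j :: s) = fun b => b ord0 j *: w (enum_val j) + phis s b.
    by apply/funext => b; rewrite /phis big_cons.
  apply: cvgD; [exact: nbhs_filter| |exact: IH].
  apply: (@cvg_comp _ _ _ (fun b : 'rV[R]_#|I| => b ord0 j) (fun c => c *: w (enum_val j))).
    exact: coord_continuous.
  exact: scalel_continuous.
have phi_cont : continuous phi by exact: phis_cont.
pose K := [set a : 'rV[R]_#|I| | forall j, `[- (M + 1), M + 1]%classic (a ord0 j)].
have cK : compact (phi @` K).
  apply: continuous_compact; first exact: continuous_subspaceT.
  apply: (@rV_compact R #|I| (fun=> `[- (M + 1), M + 1]%classic)) => j.
  exact: segment_compact.
apply: precompact_subset (compact_precompact (@norm_hausdorff _ _) cK).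
move=> _ [v Bv <-]; exists (\row_j l (enum_val j) v).
  move=> j /=; rewrite mxE in_itv/= -ler_norml.
  exact: le_trans (lv _ _) (BM _ Bv).
rewrite /phi [RHS](reindex (@enum_val _ I))/=; last exact/onW_bij/enum_val_bij.
by apply: eq_bigr => j _; rewrite mxE.
Qed.

End finite_rank.

Section square_ratio.
Context {R : realType}.
Implicit Types a b t th C : R.

(* `a` and `b` are the masses of a cell under two measures; this is `b f^2 / (1 + f)`
   for the density `f = a / b`, and `0` on a doubly null cell. *)
Definition square_ratio a b : R := a ^+ 2 / (a + b).

Lemma square_ratio_ge0 a b : 0 <= a -> 0 <= b -> 0 <= square_ratio a b.
Proof. by move=> a0 b0; rewrite divr_ge0 ?sqr_ge0 ?addr_ge0. Qed.

Lemma square_ratio_le a b : 0 <= a -> 0 <= b -> square_ratio a b <= a.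
Proof.
move=> a0 b0; have [ab0|ab0] := eqVneq (a + b) 0.
  by rewrite /square_ratio ab0 invr0 mulr0.
rewrite /square_ratio ler_pdivrMr ?lt_neqAle ?[0 == _]eq_sym ?ab0 ?addr_ge0//.
by rewrite expr2 ler_wpM2l// lerDl.
Qed.

(** With the share [r = a / (a + b)], [square_ratio a b] is [(a + b) * r ^+ 2], and the left side is
    its excess over the tangent at [t]. If both masses vanish, both sides are 0 because
    [0^-1 = 0]. *)
Lemma square_ratio_defectE a b t : 0 <= a -> 0 <= b ->
  square_ratio a b - 2 * t * a + t ^+ 2 * (a + b) =
  (a - t * (a + b)) ^+ 2 / (a + b).
Proof.
move=> a0 b0; rewrite /square_ratio; have [ab0|ab0] := eqVneq (a + b) 0.
  by rewrite ab0 invr0 !mulr0; have -> : a = 0 by [lra|]; rewrite mulr0 subrr addr0.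
by field.
Qed.

(** The arithmetic-geometric inequality for [th * w] and [u ^+ 2 / (th * w)]. Being linear in the
    squared term, it can be summed over cells without Cauchy-Schwarz. *)
Lemma norm_le_weighted_sqr u w th : 0 < w -> 0 < th ->
  `|u| <= th * w + u ^+ 2 / w / th.
Proof.
move=> w0 th0; have -> : u ^+ 2 / w / th = `|u| ^+ 2 / (th * w).
  by rewrite real_normK ?num_real// -mulrA -invfM [w * th]mulrC.
have thw : 0 < th * w by rewrite mulr_gt0.
move: (th * w) thw (normr_ge0 u) => v v0 u0.
rewrite -(ler_pM2r v0) mulrDl divfK ?gt_eqF//; nra.
Qed.

Lemma norm_le_square_ratio_defect a b t th : 0 <= a -> 0 <= b -> 0 < th ->
  `|a - t * (a + b)| <=
  th * (a + b) + (square_ratio a b - 2 * t * a + t ^+ 2 * (a + b)) / th.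
Proof.
move=> a0 b0 th0; rewrite square_ratio_defectE//.
have [ab0|ab0] := eqVneq (a + b) 0.
  have a_eq0 : a = 0 by lra.
  by rewrite ab0 a_eq0 invr0 !mulr0 mul0r subrr normr0 addr0.
have {}ab0 : 0 < a + b by rewrite lt_neqAle eq_sym ab0 addr_ge0.
exact: norm_le_weighted_sqr.
Qed.

Variables (L : finType) (a b : L -> R).
Hypotheses (a0 : forall l, 0 <= a l) (b0 : forall l, 0 <= b l).
Variables A B : R.
Hypotheses (AE : A = \sum_l a l) (BE : B = \sum_l b l).
Let A0 : 0 <= A. Proof. by rewrite AE sumr_ge0. Qed.
Let B0 : 0 <= B. Proof. by rewrite BE sumr_ge0. Qed.

(** The slope [A / (A + B)] is the share in the merged cell; with it the linear and constant terms
    add up to [- square_ratio A B]. *)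
Let sum_defect : \sum_l (square_ratio (a l) (b l)
    - 2 * (A / (A + B)) * a l + (A / (A + B)) ^+ 2 * (a l + b l)) =
  \sum_l square_ratio (a l) (b l) - square_ratio A B.
Proof.
rewrite big_split/= sumrB -!mulr_sumr big_split/= -AE -BE.
have [AB0|AB0] := eqVneq (A + B) 0.
  by rewrite /square_ratio AB0 invr0; ring.
by rewrite /square_ratio; field.
Qed.

Lemma square_ratio_sum_le :
  square_ratio A B <= \sum_l square_ratio (a l) (b l).
Proof.
rewrite -subr_ge0 -sum_defect; apply: sumr_ge0 => l _.
by rewrite square_ratio_defectE// divr_ge0 ?sqr_ge0 ?addr_ge0.
Qed.

Lemma cell_deviation_le2 : \sum_l `|a l - b l * (A / B)| <= 2 * A.
Proof.
apply: (@le_trans _ _ (\sum_l (a l + b l * (A / B)))).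
  apply: ler_sum => l _; apply: le_trans (ler_normB _ _) _.
  by rewrite !ger0_norm// mulr_ge0// divr_ge0.
rewrite big_split/= -mulr_suml -AE -BE.
have := A0; have [->|Bn0] := eqVneq B 0; first by rewrite mul0r addr0; lra.
by rewrite mulrCA divff// mulr1; lra.
Qed.

(** The bound is first obtained for shares [a l / (a l + b l)]; passing to densities relative to [b]
    costs the factor [(A + B) / B], which [A <= C * B] keeps below [1 + C]. *)
Lemma cell_deviation_le th C : 0 < th -> 0 <= C -> A <= C * B ->
  \sum_l `|a l - b l * (A / B)| <=
  (1 + C) * (th * (A + B) + (\sum_l square_ratio (a l) (b l) - square_ratio A B) / th).
Proof.
move=> th0 C0 AB.
have gap0 : 0 <= \sum_l square_ratio (a l) (b l) - square_ratio A B.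
  by rewrite subr_ge0 square_ratio_sum_le.
have [Bz|Bn0] := eqVneq B 0.
  apply: (@le_trans _ _ 0).
    apply: le_trans cell_deviation_le2 _; move: AB; rewrite Bz mulr0; lra.
  apply: mulr_ge0; first by rewrite addr_ge0.
  by apply: addr_ge0; [apply: mulr_ge0|apply: divr_ge0] => //; rewrite ?(ltW th0)// addr_ge0.
have Bgt0 : 0 < B by rewrite lt_neqAle eq_sym Bn0.
have ABgt0 : 0 < A + B by rewrite ltr_wpDl.
have kC : (A + B) / B <= 1 + C by rewrite ler_pdivrMr// mulrDl mul1r; lra.
set t := A / (A + B).
have <- : \sum_l (1 + C) * (th * (a l + b l) + (square_ratio (a l) (b l)
      - 2 * t * a l + t ^+ 2 * (a l + b l)) / th) =
    (1 + C) * (th * (A + B) + (\sum_l square_ratio (a l) (b l) - square_ratio A B) / th).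
  by rewrite -mulr_sumr big_split/= -mulr_sumr -mulr_suml sum_defect big_split/= -AE -BE.
apply: ler_sum => l _.
have -> : a l - b l * (A / B) = (A + B) / B * (a l - t * (a l + b l)).
  by rewrite /t; field; rewrite ?gt_eqF.
rewrite normrM ger0_norm ?divr_ge0 ?addr_ge0//; apply: ler_pM => //.
  by rewrite divr_ge0 ?addr_ge0.
exact: norm_le_square_ratio_defect.
Qed.

End square_ratio.

(** * Finite partitions and compression *)

Section partitions.
Context d (T : measurableType d) (R : realType).

Record measurable_partition (I : finType) (E : I -> set T) : Prop := {
  partition_measurable : forall i, measurable (E i);
  partition_trivIset : trivIset setT E;
  partition_cover : \bigcup_i E i = setT }.

Lemma fin_additive_partition (m : set T -> R) (I : finType) (E : I -> set T) A :
  fin_additive m -> measurable_partition E -> measurable A ->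
  m A = \sum_i m (E i `&` A).
Proof.
move=> addm [mE tE cE] mA.
rewrite -(fin_additive_big addm xpredT (E := fun i => E i `&` A)).
- congr m; rewrite -bigcup_seq -setI_bigcupl -[LHS]setTI -cE.
  congr (_ `&` _); apply/seteqP; split=> x [i _ Eix]; exists i => //=.
  exact: mem_index_enum.
- by move=> i; exact: measurableI.
- exact: trivIset_setIr.
Qed.

Lemma measurable_partition_meet (I L : finType) (E : I -> set T) (F : L -> set T) :
  measurable_partition E -> measurable_partition F ->
  measurable_partition (fun il : I * L => E il.1 `&` F il.2).
Proof.
move=> [mE /trivIsetP tE cE] [mF /trivIsetP tF cF]; split.
- by move=> [i l]; exact: measurableI.
- apply/trivIsetP => -[i l] [j k] _ _ /=; rewrite xpair_eqE negb_and => /orP[ij|lk].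
    by rewrite setIACA tE// set0I.
  by rewrite setIACA tF// setI0.
- rewrite -subTset => x _.
  have [i _ Eix] : (\bigcup_i E i) x by rewrite cE.
  have [l _ Flx] : (\bigcup_l F l) x by rewrite cF.
  by exists (i, l).
Qed.

Lemma bounded_measurable_square_ratio (f : T -> R) c : bounded_measurable f ->
  (forall x, 0 <= f x) -> 0 <= c ->
  bounded_measurable (fun x => square_ratio (f x) c).
Proof.
move=> [mf [M fM]] f0 c0; split; last first.
  exists M => x; rewrite ger0_norm ?square_ratio_ge0//.
  apply: le_trans (square_ratio_le (f0 x) c0) _.
  exact: le_trans (ler_norm _) (fM x).
have [->|cn0] := eqVneq c 0.
  rewrite (_ : (fun x => _) = f)//; apply/funext => x.
  rewrite /square_ratio addr0 expr2; have [->|fn0] := eqVneq (f x) 0; first by rewrite !mul0r.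
  by rewrite mulfK.
have cgt0 : 0 < c by rewrite lt_neqAle eq_sym cn0.
(* The absolute value makes [h] continuous on the whole line without changing it on nonnegative
   arguments. *)
pose h (a : R) := a ^+ 2 / (`|a| + c).
rewrite (_ : (fun x => _) = h \o f); last first.
  by apply/funext => x; rewrite /h /= ger0_norm.
apply: measurableT_comp => //; apply: continuous_measurable_fun => a.
apply: cvgM; first exact: exprn_continuous.
apply: cvgV; first by rewrite gt_eqF// ltr_wpDl.
by apply: cvgD; [exact: norm_continuous|exact: cvg_cst].
Qed.

End partitions.

Section quasicompactness.
Context d (T : measurableType d) (R : realType).
Variables (p : R.-pker T ~> T) (mu : ba T R).
Hypothesis Dmu : Delta_ba p = [set mu].
Let P := transition p.

Let Smu : S_ba mu.
Proof. by have [] : Delta_ba p mu by rewrite Dmu. Qed.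
Let mu0 : forall E, measurable E -> 0 <= mu E := Smu.1.
Let mmu : mean (ba_integral mu) := mean_ba_integral Smu.
Let addmu : fin_additive mu := @ba_additive _ _ _ mu.

(* `E` nearly maximizes the mean of `\sum_i square_ratio (P^m 1_(E i)) (mu (E i))`,
   a bounded quantity that increases under refinement.  Hence refining `E` gains
   little, which says that the density of `P^m(y, .)` relative to `mu` is nearly
   constant on the cells, for all `y` outside a set that `P^m` hardly charges. *)
Lemma compression : exists (m : nat) (I : finType) (E : I -> set T),
  [/\ (0 < m)%N, measurable_partition E &
    forall (L : finType) (F : L -> set T) x, measurable_partition F ->
    \sum_l `|iter m P (fun y => iter m P \1_(F l) y -
      \sum_i iter m P \1_(E i) y * (mu (E i `&` F l) / mu (E i))) x| <= 2^-1].
Proof.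
(* The final budget is [2 * e] for the exceptional set [V], [2 * e] for cells of high density and
   1/4 for the others, in total 1/2. *)
pose e : R := 16^-1; have e0 : 0 < e by rewrite invr_gt0.
have [delta delta0 [n small]] := iter_small Dmu e0.
pose q A y := iter n.+1 P \1_A y.
have mQ y : mean (fun f => iter n.+1 P f y) := mean_iter p n.+1 y.
have bq A : measurable A -> bounded_measurable (q A).
  by move=> mA; exact/bounded_measurable_iter/bounded_measurable_indic.
have addq y : fin_additive (q ^~ y).
  by move=> A B mA mB AB; exact: (blf_indicD (mean_blf (mQ y))).
have q0 y A : measurable A -> 0 <= q A y.
  by move=> mA; have /andP[] := mean_indic01 (mQ y) mA.
have q1 y : q setT y = 1.
  rewrite -(mean1 (mQ y)) /q; congr (iter _ _ _ y).
  by apply/funext => z; rewrite indicE in_setT.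
have sumq (I : finType) (E : I -> set T) y : measurable_partition E ->
    \sum_i q (E i) y = 1.
  move=> pE; rewrite -(q1 y) (fin_additive_partition (addq y) pE)//.
  by apply: eq_bigr => i _; rewrite setIT.
have summu (I : finType) (E : I -> set T) : measurable_partition E ->
    \sum_i mu (E i) = 1.
  move=> pE; rewrite -(S_baT Smu) (fin_additive_partition addmu pE)//.
  by apply: eq_bigr => i _; rewrite setIT.
(* Cells of density above [C] have total [mu]-mass at most [1 / C = delta], so [small] applies to
   their union. *)
pose C := delta^-1; have C0 : 0 < C by rewrite invr_gt0.
(* In [(1 + C) * (3 * th) = 4^-1], two [th] pay for the total masses of [q] and [mu], and one for
   [gap y / th] off [V]. *)
pose th := (12 * (1 + C))^-1; have th0 : 0 < th.
  by rewrite invr_gt0 mulr_gt0// addr_gt0.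
have Cth : (1 + C) * (3 * th) = 4^-1.
  by rewrite /th; field; rewrite gt_eqF// addr_gt0.
(* Chosen so that Markov's inequality at level [th ^+ 2] bounds [mu V] by [delta]. *)
pose eta := delta * th ^+ 2; have eta0 : 0 < eta by rewrite mulr_gt0// exprn_gt0.
pose H (I : finType) (E : I -> set T) y := \sum_i square_ratio (q (E i) y) (mu (E i)).
have bH (I : finType) (E : I -> set T) : measurable_partition E ->
    bounded_measurable (H I E).
  move=> [mE _ _]; apply: bounded_measurable_sum => i.
  by apply: bounded_measurable_square_ratio; [exact: bq|move=> y; exact: q0|exact: mu0].
pose S := [set v | exists (I : finType) (E : I -> set T),
  measurable_partition E /\ v = ba_integral mu (H I E)].
have S1 v : S v -> v <= 1.
  move=> [I [E [pE ->]]]; rewrite -(mean1 mmu).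
  apply: mean_le => //; [exact: bH|exact: bounded_measurable_cst|move=> y].
  rewrite /= -(sumq I E y pE); have [mE _ _] := pE.
  by apply: ler_sum => i _; apply: square_ratio_le; [exact: q0|exact: mu0].
have supS : has_sup S.
  split; last by exists 1 => v; exact: S1.
  exists (ba_integral mu (H unit (fun=> setT))), unit, (fun=> setT); split => //.
  split => //; first by apply/trivIsetP => -[] [].
  by rewrite -subTset => x _; exists tt.
have [_ [I [E [pE ->]]] supE] := sup_adherent eta0 supS.
have [mE tE cE] := pE.
exists n.+1, I, E; split => // L F x pF; have [mF _ _] := pF.
pose G (il : I * L) := E il.1 `&` F il.2.
have pG : measurable_partition G by exact: measurable_partition_meet.
have mG il : measurable (G il) by case: pG.
pose gap_ i y := \sum_l square_ratio (q (G (i, l)) y) (mu (G (i, l)))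
  - square_ratio (q (E i) y) (mu (E i)).
have qE i y : q (E i) y = \sum_l q (G (i, l)) y.
  rewrite (fin_additive_partition (addq y) pF)//.
  by apply: eq_bigr => l _; rewrite setIC.
have muE i : mu (E i) = \sum_l mu (G (i, l)).
  rewrite (fin_additive_partition addmu pF)//.
  by apply: eq_bigr => l _; rewrite setIC.
have gap_ge0 i y : 0 <= gap_ i y.
  rewrite subr_ge0; apply: square_ratio_sum_le => // l; first exact: q0.
  exact: mu0.
pose gap y := H _ G y - H _ E y.
have gapE y : gap y = \sum_i gap_ i y.
  by rewrite /gap_ sumrB pair_bigA; congr (_ - _); apply: eq_bigr => -[].
have bgap : bounded_measurable gap by apply: bounded_measurableB; exact: bH.
have gap0 y : 0 <= gap y by rewrite gapE sumr_ge0.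
have mugap : ba_integral mu gap <= eta.
  rewrite (blfB (mean_blf mmu)); [|exact: bH..].
  have : ba_integral mu (H _ G) <= sup S by apply: ub_le_sup; [case: supS|exists _, G].
  by move: supE; lra.
pose dev_ i l y := q (G (i, l)) y - mu (G (i, l)) * (q (E i) y / mu (E i)).
pose g y := \sum_i \sum_l `|dev_ i l y|.
have bdev i l : bounded_measurable (dev_ i l).
  apply: bounded_measurableB; first exact: bq.
  rewrite (_ : (fun y => _) = fun y => (mu (G (i, l)) / mu (E i)) * q (E i) y).
    exact/bounded_measurableZ/bq.
  by apply/funext => y; rewrite mulrA mulrAC.
have bg : bounded_measurable g.
  apply: bounded_measurable_sum => i; apply: bounded_measurable_sum => l.
  exact: bounded_measurable_norm.
have dev2 i y : \sum_l `|dev_ i l y| <= 2 * q (E i) y.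
  by apply: (cell_deviation_le2 (b := fun l => mu (G (i, l)))) => // l; [exact: q0|exact: mu0].
have g2 y : g y <= 2.
  apply: (@le_trans _ _ (\sum_i 2 * q (E i) y)); first exact: ler_sum.
  by rewrite -mulr_sumr sumq// mulr1.
have g_le y : g y <= 2 * e + (1 + C) * (2 * th + gap y / th).
  pose bad i := C * mu (E i) < q (E i) y.
  pose B := \big[setU/set0]_(i | bad i) E i.
  have mB : measurable B by exact: bigsetU_measurable.
  have qB : q B y = \sum_(i | bad i) q (E i) y by exact: (fin_additive_big (addq y)).
  have muB : mu B <= delta.
    rewrite (fin_additive_big addmu)// -(ler_pM2l C0) mulVf ?gt_eqF// mulr_sumr.
    have : q B y <= 1 by have /andP[] := mean_indic01 (mQ y) mB.
    by rewrite qB; apply: le_trans; apply: ler_sum => i; exact: ltW.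
  have {}qB : \sum_(i | bad i) q (E i) y <= e by rewrite -qB; exact: small.
  rewrite /g (bigID bad)/=; apply: lerD.
    apply: (@le_trans _ _ (\sum_(i | bad i) 2 * q (E i) y)); first exact: ler_sum.
    by rewrite -mulr_sumr ler_pM2l.
  apply: (@le_trans _ _ (\sum_i (1 + C) * (th * (q (E i) y + mu (E i)) + gap_ i y / th))).
    rewrite [leRHS](bigID bad)/= -[leLHS]add0r; apply: lerD.
      apply: sumr_ge0 => i _; apply: mulr_ge0; first by rewrite addr_ge0// ltW.
      rewrite addr_ge0 ?divr_ge0 ?(ltW th0)// mulr_ge0 ?(ltW th0)//.
      by rewrite addr_ge0 ?q0 ?mu0.
    apply: ler_sum => i; rewrite -leNgt => qC.
    apply: (cell_deviation_le (b := fun l => mu (G (i, l)))) => //.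
    - by move=> l; exact: q0.
    - by move=> l; exact: mu0.
    - exact: ltW.
  rewrite -mulr_sumr big_split/= -mulr_sumr -mulr_suml big_split/= sumq// summu//.
  by rewrite -gapE [th * _]mulrC.
pose V := [set y | th ^+ 2 <= gap y].
have mV : measurable V.
  rewrite -[V]setTI; apply: measurable_fun_le => //.
  by case: bgap.
have muV : mu V <= delta.
  have th20 : 0 < th ^+ 2 by rewrite exprn_gt0.
  have := mean_markov mmu bgap gap0 th20; rewrite -/V ba_integral_indic//.
  by move=> /le_trans/(_ mugap); rewrite mulrC ler_pM2r.
have bV := bounded_measurable_indic R mV.
have gV y : g y <= 2 * \1_V y + (2 * e + 4^-1).
  rewrite indicE; have [yV|/negP yV] := boolP (y \in V).
    by have := g2 y; rewrite /=; lra.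
  have {}yV : gap y < th ^+ 2.
    by rewrite ltNge; apply/negP => yV'; apply: yV; apply/mem_set.
  rewrite mulr0 add0r; apply: le_trans (g_le y) _; rewrite lerD2l -Cth.
  rewrite ler_pM2l ?addr_gt0//.
  have : gap y / th <= th by rewrite ler_pdivrMr// -expr2 ltW.
  lra.
(* The bound on [g] fails only on [V]; a second application of the power gives [V] weight at most
   [e] from every starting point. *)
have Qg : iter n.+1 P g x <= 2^-1.
  have bC := bounded_measurable_cst T (2 * e + 4^-1).
  apply: le_trans (mean_le (mQ x) bg _ gV) _.
    exact: bounded_measurableD (bounded_measurableZ 2 bV) bC.
  rewrite (blfD (mean_blf (mQ x)))//; last exact: bounded_measurableZ.
  rewrite (blfZ (mean_blf (mQ x)))// (mean_cst (mQ x)).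
  have := small V x mV muV; rewrite /e; lra.
pose D l y := q (F l) y - \sum_i q (E i) y * (mu (E i `&` F l) / mu (E i)).
have DE l y : D l y = \sum_i dev_ i l y.
  rewrite /D (fin_additive_partition (addq y) pE)// -sumrB; apply: eq_bigr => i _.
  by congr (_ - _); exact: mulrCA.
have bD l : bounded_measurable (D l).
  rewrite (_ : D l = fun y => \sum_i dev_ i l y); last exact/funext/DE.
  exact: bounded_measurable_sum.
apply: le_trans Qg.
apply: (@le_trans _ _ (\sum_l iter n.+1 P (fun y => `|D l y|) x)).
  by apply: ler_sum => l _; exact: (mean_norm_le (mQ x) (bD l)).
have bnD l : bounded_measurable (fun y => `|D l y|) by exact: bounded_measurable_norm.
rewrite -(blf_sum (mean_blf (mQ x)))//.
apply: (mean_le (mQ x)) => //; first exact: bounded_measurable_sum.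
move=> y; rewrite /g exchange_big/=; apply: ler_sum => l _.
by rewrite DE; exact: ler_norm_sum.
Qed.

End quasicompactness.

(** * Quasicompactness and the main theorem *)

Section condition_K.
Context d (T : measurableType d) (R : realType).

Lemma ba_integral_linear (a : R) (u v : ba T R) f : bounded_measurable f ->
  ba_integral (a *: u + v) f = a * ba_integral u f + ba_integral v f.
Proof.
have bu := bounded_functional_ba_integral u.
have bv := bounded_functional_ba_integral v.
have bL : bounded_functional (`|a| * `|u| + `|v|)
    (fun f => a * ba_integral u f + ba_integral v f).
  split=> [g h bg bh|b g bg|g k bg gk].
  - by rewrite (blfD bu)// (blfD bv)//; ring.
  - by rewrite (blfZ bu)// (blfZ bv)//; ring.
  - apply: le_trans (ler_normD _ _) _; rewrite mulrDr; apply: lerD.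
      by rewrite normrM mulrCA ler_wpM2l//; exact: (blf_le bu).
    exact: (blf_le bv).
move=> bf; apply: (ba_integral_blf bL) => // F mF.
by rewrite !ba_integral_indic.
Qed.

(** With [c = (mu A)^-1] this is [mu] conditioned on [A], or the zero measure when [A] is null, as
    [0^-1 = 0]. *)
Lemma ca_restriction (mu : ba T R) (c : R) A : continuous_at_empty mu ->
  measurable A ->
  exists w : ca T R, forall F, measurable F -> w F = mu (A `&` F) * c.
Proof.
move=> muc mA; pose w F := if `[< measurable F >] then mu (A `&` F) * c else 0.
have wE F : measurable F -> w F = mu (A `&` F) * c by move=> mF; rewrite /w asboolT.
have [M Mmu] := ba_bounded mu.
have wba : w \in @is_ba d T R.
  apply/asboolP; split=> [F nF|F G mF mG FG|].
  - by rewrite /w asboolF.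
  - rewrite !wE//; last exact: measurableU.
    rewrite setIUr ba_additive ?mulrDl//; try exact: measurableI.
    by rewrite setIACA FG setI0.
  - exists (M * `|c|) => F mF; rewrite wE// normrM ler_wpM2r// Mmu//.
    exact: measurableI.
have wc : continuous_at_empty (Ba wba).
  move=> F mF Fni F0; rewrite (_ : (fun n => _) = fun n => mu (A `&` F n) * c).
    rewrite -[X in _ --> X](mul0r c); apply: cvgMl.
    apply: (muc (fun n => A `&` F n)) => [n|i j ij|].
    - exact: measurableI.
    - exact: setIS (Fni _ _ ij).
    - rewrite -subset0 => x AFx; rewrite -F0 => n _.
      by have [] := AFx n Logic.I.
  by apply/funext => n; exact: wE.
by exists (Ca (continuous_at_empty_ca wc)).
Qed.

Lemma ca_sumE (I : Type) (s : seq I) (c : I -> R) (w : I -> ca T R) F :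
  (\sum_(i <- s) c i *: w i : ca T R) F = \sum_(i <- s) c i * w i F.
Proof.
elim: s => [|i s IH]; first by rewrite !big_nil.
by rewrite !big_cons -IH.
Qed.

Variables (p : R.-pker T ~> T) (mu : ba T R).
Hypothesis Dmu : Delta_ba p = [set mu].
Let P := transition p.

Lemma invariant_condition_K : condition_K p.
Proof.
have [m [I [E [m0 pE dev]]]] := compression Dmu; have [mE _ _] := pE.
have /choice[w wE] i : exists w : ca T R,
    forall F, measurable F -> w F = mu (E i `&` F) * (mu (E i))^-1.
  by apply: ca_restriction => //; exact: (invariant_continuous_at_empty Dmu).
pose k := (m + m)%N.
have bP A : measurable A -> bounded_measurable (iter k P \1_A).
  by move=> mA; exact/bounded_measurable_iter/bounded_measurable_indic.
pose l i (nu : ca T R) := ba_integral nu (iter k P \1_(E i)).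
(* The image of [nu] under the [k]-th power keeps its masses on the cells and is redistributed
   inside each of them according to [mu]. *)
pose A (nu : ca T R) := \sum_i l i nu *: w i.
have linA : linear A.
  move=> a u v; rewrite /A scaler_sumr -big_split/=; apply: eq_bigr => i _.
  rewrite scalerA -scalerDl; congr (_ *: _).
  by rewrite /l -ba_integral_linear//; exact: bP.
pose A1 : {linear ca T R -> ca T R} := HB.pack A (GRing.isLinear.Build R _ _ _ A linA).
exists A1, k; split.
- apply: finite_rank_compact => i nu; rewrite /l -[leRHS]mul1r.
  apply: (blf_le (bounded_functional_ba_integral nu)); first exact: bP.
  move=> x; have /andP[? ?] := mean_indic01 (mean_iter p k x) (mE i).
  by rewrite ger0_norm.
- by rewrite addn_gt0 m0.
- apply: (@le_lt_trans _ _ (2^-1)%:E); last by rewrite lte_fin; lra.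
  apply: ge_ereal_sup => _ [nu /= nu1 <-]; rewrite lee_fin.
  apply: (@le_trans _ _ (2^-1 * `|nu|)); last by rewrite ler_piMr.
  apply: ge_sup; first exact: partition_sums_neq0.
  move=> _ [r [F [mF tF cF ->]]].
  have pF : measurable_partition F by [].
  pose h j x := iter m P (fun y => iter m P \1_(F j) y -
    \sum_i iter m P \1_(E i) y * (mu (E i `&` F j) / mu (E i))) x.
  have bh j : bounded_measurable (h j).
    apply: bounded_measurable_iter; apply: bounded_measurableB.
      exact/bounded_measurable_iter/bounded_measurable_indic.
    apply: bounded_measurable_sum => i.
    rewrite (_ : (fun y => _) = fun y => (mu (E i `&` F j) / mu (E i)) * iter m P \1_(E i) y).
      exact/bounded_measurableZ/bounded_measurable_iter/bounded_measurable_indic.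
    by apply/funext => y; rewrite mulrC.
  have hE j x : h j x = iter k P \1_(F j) x -
      \sum_i (mu (E i `&` F j) / mu (E i)) * iter k P \1_(E i) x.
    have bL := mean_blf (mean_iter p m x).
    have bE i : bounded_measurable (iter m P \1_(E i)).
      exact/bounded_measurable_iter/bounded_measurable_indic.
    rewrite /h /k iterD; under [in X in iter m P X]eq_fun do under eq_bigr do rewrite mulrC.
    rewrite (blfB bL); last first.
    - by apply: bounded_measurable_sum => i; exact: bounded_measurableZ.
    - exact/bounded_measurable_iter/bounded_measurable_indic.
    rewrite (blf_sum bL) => [|i]; last exact: bounded_measurableZ.
    congr (_ - _); apply: eq_bigr => i _.
    by rewrite (blfZ bL)// iterD.
  have bI := bounded_functional_ba_integral nu.
  have diffE j : (iter k (markov_ca p) nu - A1 nu : ca T R) (F j) =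
      ba_integral nu (h j).
    rewrite (_ : h j = fun x => iter k P \1_(F j) x -
      \sum_i (mu (E i `&` F j) / mu (E i)) * iter k P \1_(E i) x); last exact/funext/hE.
    rewrite (blfB bI); [|exact: bP|]; last first.
      by apply: bounded_measurable_sum => i; exact/bounded_measurableZ/bP.
    rewrite (blf_sum bI) => [|i]; last exact/bounded_measurableZ/bP.
    rewrite -ba_integral_iter_markov; last exact: bounded_measurable_indic.
    rewrite ba_integral_indic// -iter_markov_ca.
    transitivity ((iter k (markov_ca p) nu : ca T R) (F j) - A nu (F j)) => //.
    congr (_ - _); rewrite /A ca_sumE; apply: eq_bigr => i _.
    by rewrite wE// (blfZ bI) 1?mulrC//; exact: bP.
  under eq_bigr do rewrite diffE.
  (* Putting the signs inside turns the variation sum into a single integral against [nu];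
     [compression] bounds [f] by 1/2 everywhere, whatever the partition. *)
  pose f x := \sum_j Num.sg (ba_integral nu (h j)) * h j x.
  have -> : \sum_j `|ba_integral nu (h j)| = ba_integral nu f.
    rewrite (blf_sum bI) => [|j]; last exact: bounded_measurableZ.
    by apply: eq_bigr => j _; rewrite (blfZ bI)// -normrEsg.
  apply: le_trans (ler_norm _) _; apply: (blf_le bI).
    by apply: bounded_measurable_sum => j; exact: bounded_measurableZ.
  move=> x; apply: le_trans (dev _ F x pF); apply: le_trans (ler_norm_sum _ _ _) _.
  apply: ler_sum => j _; rewrite normrM ler_piMl//.
  by rewrite normr_sg; case: (_ != 0).
Qed.

End condition_K.

Theorem theorem5p3 (R : realType) (d : measure_display) (T : measurableType d)
  (infT : infinite_set [set: T]) (mT : forall x : T, measurable [set x])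
  (p : R.-pker T ~> T) (dim1 : has_dim (linear_span (Delta_ba p)) 1) :
  [/\ condition_D p, condition_D_tilde p, condition_K p
    & exists mu : ba T R,
        [/\ Delta_ba p = [set mu], Delta_ca p = [set mu]
          & Delta_ba p `<=` @ca_set d T R]].
Proof.
have [b [bS spanb freeb]] := dim1.
have inS nu : Delta_ba p nu -> exists a : R, nu = a *: b ord0.
  move=> Dnu; have [|a ->] := spanb nu.
    exists 1%N, (fun=> 1), (fun=> nu); split => //.
    by rewrite big_ord1 scale1r.
  by exists (a ord0); rewrite big_ord1.
(* If [Delta_ba p] were empty, its span would be zero and could not contain the free vector
   [b ord0]. *)
have [mu Dmu] : exists mu, Delta_ba p mu.
  apply: contrapT => noD; have [n [a [w [wD b0]]]] := bS ord0.
  have b00 : b ord0 = 0.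
    rewrite b0 big1// => i _; exfalso; apply: noD.
    by exists (w i); exact: wD.
  suff /(_ ord0)/eqP : forall i : 'I_1, (1 : R) = 0 by rewrite oner_eq0.
  by apply: (freeb (fun=> 1)); rewrite big_ord1 b00 scaler0.
(* All invariant probabilities are multiples of [b ord0], and total mass 1 fixes the scalar. *)
have DE : Delta_ba p = [set mu].
  apply/seteqP; split=> [nu Dnu|_ -> //].
  have [a nuE] := inS nu Dnu; have [a' muE] := inS mu Dmu.
  have nuT := S_baT Dnu.1; have muT := S_baT Dmu.1.
  have {}nuT : a * b ord0 setT = 1 by rewrite -nuT nuE.
  have {}muT : a' * b ord0 setT = 1 by rewrite -muT muE.
  have bT0 : b ord0 setT != 0.
    by apply: contra_eq_neq nuT => ->; rewrite mulr0 eq_sym oner_eq0.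
  by rewrite nuE muE; congr (_ *: _); apply: (mulIf bT0); rewrite nuT muT.
have caE : Delta_ba p `<=` @ca_set d T R.
  by rewrite DE => _ ->; exact: continuous_at_empty_ca (invariant_continuous_at_empty DE).
split.
- exact: invariant_condition_D DE.
- exact: invariant_condition_D_tilde DE.
- exact: invariant_condition_K DE.
- exists mu; split => //; rewrite -DE; apply/seteqP; split=> nu [].
    by move=> [Snu _] nuI; split.
  by move=> Snu nuI; split => //; split => //; exact: caE.
Qed.
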